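(* Let $t>1$, $\tau>2$ and $s=t(\tau-1)$. For irrational $x$ let $\mathcal F_{s,t}(x)=\sum_{n\ge1}n^{-s}|\sin(\pi nx)|^{-t}\in[0,\infty]$ and let $\mu(x)$ be its irrationality exponent. Put $$C_\tau=\{x\in\mathbb R\setminus\mathbb Q:\mu(x)=\tau,\ \mathcal F_{s,t}(x)<\infty\},\qquad E_\tau=\{x\in\mathbb R\setminus\mathbb Q:\mu(x)=\tau,\ \mathcal F_{s,t}(x)=\infty\},$$ and for $\kappa\in\mathbb R$ let $h_\kappa$ be the dimension function given for small $r>0$ by $h_\kappa(r)=r^{2/\tau}(\log(1/r))^{\kappa}$. Then $$\mathcal H^{h_\kappa}(C_\tau)=\infty\quad\text{for every }\kappa\in\mathbb R,\qquad \mathcal H^{h_\kappa}(E_\tau)=\begin{cases}0,&\kappa<-1,\\ \infty,&\kappa\ge-1.\end{cases}$$ In particular, every $h_\kappa$ with $\kappa<-1$ separates the two parts of the critical fibre $\{\mu=\tau\}=C_\tau\sqcup E_\tau$ (measure $\infty$ for $C_\tau$ and $0$ for $E_\tau$), and $\kappa=-1$ is the exact threshold at which the separation disappears.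
   Context: $\mu(x)=\inf\{\sigma>0: |x-p/q|<q^{-\sigma}\text{ for at most finitely many } p/q\in\mathbb Q\}$. $h_\kappa(r)=r^{2/\tau}(\log(1/r))^{\kappa}$ for $0<r<r_0$, with $r_0$ (depending on $\kappa,\tau$) small enough that $h_\kappa$ is increasing there with $h_\kappa(0^+)=0$, extended arbitrarily and monotonically to $[r_0,\infty)$. For a dimension function $h$, $\mathcal H^{h}(A)=\lim_{\delta\to0}\inf\{\sum_i h(\operatorname{diam}U_i): A\subseteq\bigcup_iU_i\text{ countable cover},\ \operatorname{diam}U_i\le\delta\}$ for $A\subseteq\mathbb R$. *)

(* Defs.v *)
From HB Require Import structures.
From mathcomp Require Import all_boot all_order all_algebra.
From mathcomp Require Import all_classical all_reals all_analysis.
Set Implicit Arguments.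
Unset Strict Implicit.
Unset Printing Implicit Defensive.
Import Order.TTheory GRing.Theory Num.Theory.
Import numFieldNormedType.Exports.
Local Open Scope classical_set_scope.
Local Open Scope ring_scope.

Section Definitions.
Context {R : realType}.
Implicit Types (x s t tau kappa delta : R) (h : R -> R) (A B U : set R).

(* A rational p/q is represented by r : rat in lowest terms, with q = denq r.
   For a fixed value of p/q and sigma > 0 this q makes q^(- sigma) largest, so
   unreduced fractions would yield the same set of rationals. *)
Definition irr_exponent x : \bar R :=
  ereal_inf [set sigma%:E | sigma in [set sigma : R | 0 < sigma /\
    finite_set [set r : rat |
      `|x - ratr r| < ((denq r)%:~R : R) `^ (- sigma)]]].

(* Meaningful for irrational x only: then sin (pi n x) != 0 for all n >= 1,
   whereas 0 `^ (- t) is the junk value 0 when t != 0. *)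
Definition sine_series s t x : \bar R :=
  (\sum_(1 <= n <oo)
     ((n%:R : R) `^ (- s) * `|sin (pi * n%:R * x)| `^ (- t))%:E)%E.

Definition critical_convergent s t tau : set R :=
  [set x | [/\ irrational x, irr_exponent x = tau%:E
             & (sine_series s t x < +oo)%E]].

Definition critical_divergent s t tau : set R :=
  [set x | [/\ irrational x, irr_exponent x = tau%:E
             & sine_series s t x = +oo%E]].

Definition diam U : \bar R :=
  ereal_sup [set `|z.1 - z.2|%:E | z in U `*` U].

(* Covers are indexed by nat; finite ones are padded with empty sets. As
   diam set0 = -oo and fine -oo = 0, an empty set contributes h 0, which is 0
   for a dimension function. *)
Definition hausdorff_content h delta A : \bar R :=
  ereal_inf [set (\sum_(0 <= i <oo) (h (fine (diam (U i))))%:E)%E |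
    U in [set U : nat -> set R | A `<=` \bigcup_i U i /\
                                 forall i, (diam (U i) <= delta%:E)%E]].

Definition hausdorff_measure h A : \bar R :=
  lim (hausdorff_content h delta A @[delta --> 0^'+]).

(* Only the values on [0, +oo[ matter. *)
Definition dimension_function h : Prop :=
  [/\ h 0 = 0,
      forall a b, 0 <= a -> a <= b -> h a <= h b
    & h r @[r --> 0^'+] --> (0 : R)].

Definition log_gauge tau kappa (r : R) : R :=
  r `^ (2 / tau) * (ln (1 / r)) `^ kappa.

(* h is one of the monotone extensions of the germ of log_gauge at 0^+. *)
Definition is_log_gauge tau kappa h : Prop :=
  dimension_function h /\
  exists2 r0 : R, 0 < r0 < 1 &
    forall r : R, 0 < r < r0 -> h r = log_gauge tau kappa r.

Definition separates h A B : Prop :=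
  hausdorff_measure h A = +oo%E /\ hausdorff_measure h B = 0%E.

End Definitions.

(* Main.v *)
Require Import Defs.
From mathcomp Require Import all_boot all_order all_algebra.
From mathcomp Require Import all_classical all_reals all_analysis.
From mathcomp Require Import ring lra zify.

(* The series F_{s,t}(x) is governed by its terms at best approximation
   denominators: with ||.|| the distance to the nearest integer and
   s = t(tau - 1), the term at q is about (q^(1-tau) / ||q x||)^t.

   Upper bounds.  Every point of E_tau, every rational and every point with
   mu > tau lies in the limsup set N_a of the balls B(p/q, q^(-tau) (log q)^a),
   for suitable a (any a > 0 works for E_tau).  The natural cover of N_a has
   sum_q q h_kappa(q^(-tau) (log q)^a) ~ sum_q (log q)^(2a/tau + kappa) / q,
   finite as soon as kappa + 2a/tau < -1.

   Lower bounds.  Let W be the limsup set of the balls of radius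
   r_q ~ q^(-tau) (log q)^(-(kappa+1) tau/2), kappa <= -1, so that
   h_kappa(r_q) ~ 1/(q^2 log q) =: rho_q, a borderline divergent Khintchine sum.
   In every interval one finds disjoint balls B(p/q, rho_q) filling a fixed
   proportion of it.  Given countably many sets of finite total h_kappa-weight,
   one plays a nested-ball game: among the shrunken balls B(p/q, r_q) some one
   meets only sets of tiny total weight; iterating yields a point of W avoiding
   all the sets.  Hence W minus an h_kappa-null set has infinite measure.  With
   kappa = -1 all of W \ N_{-1} lies in E_tau; with kappa <= -2 all of
   W \ N_{tau/4} lies in C_tau.  Larger kappa follow because h_kappa is
   increasing in kappa near 0. *)

Set Implicit Arguments.
Unset Strict Implicit.
Unset Printing Implicit Defensive.
Import Order.TTheory GRing.Theory Num.Theory.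
Import numFieldNormedType.Exports.
Local Open Scope classical_set_scope.
Local Open Scope ring_scope.

(** * Counting fractions *)

Section Counting.
Context {R : realType}.
Implicit Types (a b e : R).

(** Why every a > 0 is allowed for E_tau: off N_a, a denominator near 2^k contributes at most about
    k^(-a t), which is not summable over all k when a is small. But such large terms arise only
    where the minimum of ||n x|| over n < 2^(k+1) drops well below Dirichlet's bound, and a
    determinant argument shows that two such drops, at levels l < l', satisfy roughly l' >= (1 +
    eta) l. Along a lacunary sequence every negative power is summable, and the other blocks are
    dominated by geometric series. This freedom in a is what lets the null range of kappa reach up
    to -1. In the game, the weight of a set does not limit how many much shorter balls it can spoil.
    A second quantity, the total length of the sets meeting the current ball, is therefore carried
    along; since d / h_kappa(d) is almost increasing, a small weight inside a ball yields the length
    bound needed for the next move. *)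

Lemma separated_size (s : seq R) a b e : 0 < e -> a <= b -> uniq s ->
  {in s, forall x, a <= x <= b} ->
  {in s &, forall x y, x != y -> e <= `|x - y|} ->
  (size s)%:R <= (b - a) / e + 1.
Proof.
move=> e0 ab us sab sep.
pose f x := Num.truncn ((x - a) / e).
have f_inj : {in s &, injective f}.
  move=> x y xs ys fxy; apply/eqP/negPn/negP => xy.
  have /andP[ax _] := sab _ xs; have /andP[ay _] := sab _ ys.
  have := sep _ _ xs ys xy.
  have /truncn_itv : 0 <= (x - a) / e by rewrite divr_ge0// ?subr_ge0// ltW.
  have /truncn_itv : 0 <= (y - a) / e by rewrite divr_ge0// ?subr_ge0// ltW.
  rewrite -/(f x) -/(f y) -fxy !ler_pdivlMr// !ltr_pdivrMr// -natr1 mulrDl mul1r.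
  by case: ler0P; lra.
have: (size (map f s) <= size (iota 0 (Num.truncn ((b - a) / e)).+1))%N.
  apply: uniq_leq_size; first by rewrite map_inj_in_uniq.
  move=> _ /mapP[x xs ->]; rewrite mem_iota/= add0n ltnS.
  have /andP[ax xb] := sab _ xs.
  by apply: le_truncn; rewrite ler_pM2r ?invr_gt0// lerD2r.
rewrite size_map size_iota -(ler_nat R) -natr1 => /le_trans; apply.
by rewrite lerD2r truncn_le divr_ge0// ?subr_ge0// ltW.
Qed.

(** Every other interval lies wholly to the left or wholly to the right of the first one, so
    induction on their number applies to both sides separately. *)
Lemma disjoint_intervals_sum (T : eqType) (x r : T -> R) (S : seq T) a b :
  uniq S -> a <= b ->
  {in S, forall i, [/\ 0 <= r i, a <= x i - r i & x i + r i <= b]} ->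
  {in S &, forall i j, i != j -> r i + r j <= `|x i - x j|} ->
  \sum_(i <- S) 2 * r i <= b - a.
Proof.
have [n] := ubnP (size S); elim: n S a b => // n IH [|i S] a b.
  by rewrite big_nil subr_ge0.
rewrite ltnS /= => Sn /andP[iS uS] ab inS sep.
have [ri ai ib] := inS i (mem_head _ _).
rewrite big_cons (bigID (fun j => x j < x i))/=.
rewrite -(big_filter S (fun j => x j < x i)).
rewrite -(big_filter S (fun j => ~~ (x j < x i))).
have L : \sum_(j <- [seq j <- S | x j < x i]) 2 * r j <= (x i - r i) - a.
  apply: IH => //.
  - by rewrite size_filter (leq_ltn_trans (count_size _ _)).
  - by rewrite filter_uniq.
  - move=> j; rewrite mem_filter => /andP[ji jS].
    have jS' : j \in i :: S by rewrite inE jS orbT.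
    have [? ? ?] := inS j jS'; split => //.
    have := sep j i jS' (mem_head _ _); rewrite (contraNneq _ iS) => [/(_ isT)|<-//].
    by rewrite ltr0_norm ?subr_lt0//; lra.
  - move=> j k; rewrite !mem_filter => /andP[_ jS] /andP[_ kS].
    by apply: sep; rewrite inE (jS, kS) orbT.
have U : \sum_(j <- [seq j <- S | ~~ (x j < x i)]) 2 * r j <= b - (x i + r i).
  apply: IH => //.
  - by rewrite size_filter (leq_ltn_trans (count_size _ _)).
  - by rewrite filter_uniq.
  - move=> j; rewrite mem_filter -leNgt => /andP[ji jS].
    have jS' : j \in i :: S by rewrite inE jS orbT.
    have [? ? ?] := inS j jS'; split => //.
    have := sep j i jS' (mem_head _ _); rewrite (contraNneq _ iS) => [/(_ isT)|<-//].
    by rewrite ger0_norm ?subr_ge0//; lra.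
  - move=> j k; rewrite !mem_filter => /andP[_ jS] /andP[_ kS].
    by apply: sep; rewrite inE (jS, kS) orbT.
by move: L U; lra.
Qed.

Lemma count_multiples_le (B d : nat) a b : (0 < d)%N -> a <= b ->
  (count (fun p => [&& (d %| p)%N, a <= p%:R & p%:R <= b]%R) (iota 0 B))%:R
    <= (b - a) / d%:R + 1.
Proof.
move=> d0 ab; set P := fun p : nat => [&& (d %| p)%N, a <= p%:R & p%:R <= b].
rewrite -size_filter -(size_map (GRing.natmul 1 : nat -> R)).
apply: separated_size => //.
- by rewrite ltr0n.
- by rewrite map_inj_uniq ?filter_uniq ?iota_uniq//; apply: mulrIn; rewrite oner_eq0.
- by move=> _ /mapP[p + ->]; rewrite mem_filter => /andP[/and3P[_ -> ->]].
- move=> _ _ /mapP[p + ->] /mapP[q + ->]; rewrite !mem_filter.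
  move=> /andP[/and3P[dp _ _] _] /andP[/and3P[dq _ _] _].
  wlog pq : p q dp dq / (p <= q)%N.
    move=> H; have [/H|/ltnW/H] := leqP p q; first exact.
    by rewrite eq_sym distrC; exact.
  rewrite distrC -natrB// normr_nat ler_nat eqr_nat => pq'.
  by apply: dvdn_leq; [rewrite subn_gt0 ltn_neqAle pq' | rewrite dvdn_sub].
Qed.

Lemma count_naturals_ge (B : nat) a b : 0 <= a -> a <= b -> b < B%:R ->
  b - a - 1 <= (count (fun p => (a <= p%:R) && (p%:R <= b))%R (iota 0 B))%:R.
Proof.
move=> a0 ab bB; set P := fun p : nat => (a <= p%:R) && (p%:R <= b).
rewrite -size_filter.
have b0 : 0 <= b by lra.
have /andP[ta ta'] := truncn_itv a0; have /andP[tb tb'] := truncn_itv b0.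
have tab : (Num.truncn a <= Num.truncn b)%N by exact: le_truncn.
pose s := iota (Num.truncn a).+1 (Num.truncn b - Num.truncn a).
have : (size s <= size [seq p <- iota 0 B | P p])%N.
  apply: uniq_leq_size; first exact: iota_uniq.
  move=> p; rewrite mem_iota mem_filter mem_iota/= add0n => /andP[ap pb].
  have pb' : (p <= Num.truncn b)%N by lia.
  have h1 : a < p%:R by apply: lt_le_trans ta' _; rewrite ler_nat.
  have h2 : p%:R <= b by apply: le_trans tb; rewrite ler_nat.
  by rewrite /P (ltW h1) h2/= -(ltr_nat R) (le_lt_trans h2).
rewrite size_iota -(ler_nat R) natrB// => h; apply: le_trans h.
by move: ta' tb'; rewrite -!natr1; lra.
Qed.

Lemma sum_inv_sqr (m n : nat) : (0 < m)%N -> (m <= n)%N ->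
  \sum_(m.+1 <= d < n.+1) (d%:R ^+ 2)^-1 <= 1 / m%:R - 1 / n%:R :> R.
Proof.
move=> m0; elim: n => [|n IH]; first by rewrite leqn0; case: m m0.
rewrite leq_eqVlt => /predU1P[<-|]; first by rewrite big_geq// subrr.
rewrite ltnS => mn; rewrite big_nat_recr//=.
have n0 : 0 < n%:R :> R by rewrite ltr0n (leq_trans m0).
have : (n.+1%:R ^+ 2)^-1 <= 1 / n%:R - 1 / n.+1%:R :> R.
  have -> : 1 / n%:R - 1 / n.+1%:R = (n%:R * n.+1%:R)^-1 :> R.
    by rewrite -natr1; field; apply/andP; split; lra.
  rewrite lef_pV2 ?posrE ?mulr_gt0 ?exprn_gt0// ?ltr0n// expr2 ler_pM2r//.
  by rewrite ler_nat.
by move=> h; apply: le_trans (lerD (IH mn) h) _; rewrite addrA subrK.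
Qed.

(* AM-GM: [1/d <= (K/d^2 + 1/K)/2]. *)
Lemma sum_inv_le (K : R) (m n : nat) : 0 < K -> (1 < m)%N ->
  \sum_(m <= d < n) d%:R^-1 <= K + n%:R / K :> R.
Proof.
move=> K0 m1; have [nm|mn] := leqP n m.
  by rewrite big_geq// addr_ge0 ?divr_ge0// ltW.
have h : \sum_(m <= d < n) d%:R^-1 <= \sum_(m <= d < n) (K * (d%:R ^+ 2)^-1 + K^-1) :> R.
  apply: ler_sum_nat => d /andP[md _].
  have d0 : 0 < d%:R^-1 :> R by rewrite invr_gt0 ltr0n; lia.
  rewrite -exprVn; move: (d%:R^-1 : R) d0 => u u0.
  have Ki : K * K^-1 = 1 by rewrite divff// gt_eqF.
  have Ki0 : 0 < K^-1 by rewrite invr_gt0.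
  have : 0 <= K * (u - K^-1 / 2) ^+ 2 by rewrite mulr_ge0 ?sqr_ge0// ltW.
  have -> : K * (u - K^-1 / 2) ^+ 2 = K * u ^+ 2 - (K * K^-1) * u + (K * K^-1) * K^-1 / 4.
    by field; rewrite gt_eqF.
  by rewrite Ki; lra.
apply: le_trans h _; rewrite big_split/= -mulr_sumr sumr_const_nat.
apply: lerD.
  rewrite ger_pMr//; case: m m1 mn => // m m1; case: n => // n mn.
  apply: le_trans (sum_inv_sqr _ _) _ => //; first exact: ltnW.
  have : 0 <= 1 / n%:R :> R by rewrite divr_ge0.
  have : 1 / m%:R <= 1 :> R by rewrite mul1r invf_le1 ?ltr0n// ler1n.
  lra.
by rewrite -[K^-1 *+ _]mulr_natl ler_pM2r ?invr_gt0// ler_nat leq_subr.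
Qed.
End Counting.

(** * Distinct fractions with denominators in a window *)

Section Fractions.
Context {R : realType}.
Implicit Types (a b e : R).

Lemma frac_separated (p q p' q' : nat) : (0 < q)%N -> (0 < q')%N ->
  p%:R / q%:R != p'%:R / q'%:R :> R ->
  (q%:R * q'%:R)^-1 <= `|p%:R / q%:R - p'%:R / q'%:R| :> R.
Proof.
move=> q0 q'0 ne.
have Q0 : q%:R != 0 :> R by rewrite pnatr_eq0 -lt0n.
have Q'0 : q'%:R != 0 :> R by rewrite pnatr_eq0 -lt0n.
have -> : p%:R / q%:R - p'%:R / q'%:R = ((p * q')%N%:Z - (p' * q)%N%:Z)%:~R / (q%:R * q'%:R) :> R.
  by rewrite intrB -!pmulrn !natrM; field; rewrite Q0 Q'0.
rewrite normrM [`|_^-1|]ger0_norm ?invr_ge0 ?mulr_ge0//.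
rewrite ler_peMl ?invr_ge0 ?mulr_ge0// -intr_norm (_ : 1 = 1%:~R)// ler_int.
rewrite -gtz0_ge1 normr_gt0 subr_eq0; apply: contra ne => /eqP [e].
by rewrite eqr_div// -!natrM e.
Qed.

(* As q >= 16 n and gcdn p q < 16, the reduced denominator exceeds n; it divides
   q and q', whose distance is less than n. *)
Lemma frac_inj (n p q p' q' : nat) : (0 < n)%N ->
  (16 * n <= q < 17 * n)%N -> (16 * n <= q' < 17 * n)%N -> (gcdn p q < 16)%N ->
  (p * q' = p' * q)%N -> p = p' /\ q = q'.
Proof.
move=> n0 /andP[q1 q2] /andP[q1' q2'] g e.
have q0 : (0 < q)%N by lia.
set d := gcdn p q in g; have d0 : (0 < d)%N by rewrite gcdn_gt0 q0 orbT.
have [u pu] : exists u, p = (u * d)%N by apply/dvdnP/dvdn_gcdl.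
have [v qv] : exists v, q = (v * d)%N by apply/dvdnP/dvdn_gcdr.
have cuv : coprime v u.
  rewrite coprime_sym /coprime -(eqn_pmul2r d0) muln_gcdl -pu -qv mul1n; exact/eqP.
have v0 : (n < v)%N by nia.
have e' : (u * q' = p' * v)%N.
  apply/eqP; rewrite -(eqn_pmul2r d0); apply/eqP.
  by rewrite mulnAC -pu e qv mulnA.
have vq' : (v %| q')%N.
  by rewrite -(Gauss_dvdr _ cuv) e' dvdn_mull.
have vq : (v %| q)%N by rewrite qv dvdn_mulr.
suff qq : q = q'.
  by split=> //; move: e; rewrite -qq => /eqP; rewrite eqn_pmul2r// => /eqP.
case: (ltngtP q q') => [lt|gt|//].
- have : (v %| q' - q)%N by rewrite dvdn_sub.
  by move/dvdn_leq; lia.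
- have : (v %| q - q')%N by rewrite dvdn_sub.
  by move/dvdn_leq; lia.
Qed.

(** Asking for gcd below 16 instead of coprimality avoids estimating Euler's function: about 17 n^2
    l / d^2 pairs have the common divisor d, and the sum of d^(-2) over d >= 16 is at most 1/15, so
    most of the roughly 16 n^2 l pairs survive. *)
Lemma count_good_fractions a b : 0 <= a -> a < b -> b <= 1 ->
  exists n0 : nat, forall n : nat, (n0 <= n)%N ->
   (b - a) * n%:R ^+ 2 <=
   (count (fun z : nat * nat => [&& (gcdn z.1 z.2 < 16)%N,
      a * z.2%:R <= z.1%:R & z.1%:R <= b * z.2%:R])
      [seq (p, q) | q <- iota (16 * n) n, p <- iota 0 (17 * n).+1])%:R.
Proof.
move=> a0 ab b1; set l := b - a; have l0 : 0 < l by rewrite subr_gt0.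
(* The error terms of order n in the final estimate, 18 n and 3600 n / l, will be absorbed by 12 l
   n^2. *)
have [n0 n0P] : exists n0 : nat, forall n : nat, (n0 <= n)%N ->
    (0 < n)%N /\ 18 + 3600 / l <= 12 * l * n%:R.
  exists (Num.truncn ((18 + 3600 / l) / (12 * l))).+1 => n n0n; split.
    by rewrite (leq_trans _ n0n).
  have c0 : 0 < 12 * l by rewrite mulr_gt0.
  rewrite -ler_pdivrMl// [leLHS]mulrC; apply: ltW.
  by apply: lt_le_trans (truncnS_gt _) _; rewrite ler_nat.
exists n0 => n /n0P[n_gt0] {n0 n0P}.
set P := fun p q : nat => (a * q%:R <= p%:R) && (p%:R <= b * q%:R).
set w := iota (16 * n) n; set v := iota 0 _.
have cntE (T : Type) (r : seq T) (Q : pred T) : (count Q r)%:R = \sum_(p <- r) (Q p)%:R :> R.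
  by elim: r => [|x r IH]; rewrite ?big_nil ?big_cons//= natrD IH.
have -> : (count (fun z : nat * nat => [&& (gcdn z.1 z.2 < 16)%N,
      a * z.2%:R <= z.1%:R & z.1%:R <= b * z.2%:R])
      [seq (p, q) | q <- w, p <- v])%:R =
   \sum_(q <- w) (count (P^~ q) v)%:R -
   \sum_(q <- w) (count (fun p => P p q && (16 <= gcdn p q)%N) v)%:R :> R.
  rewrite cntE big_allpairs_dep -sumrB; apply: eq_bigr => q _.
  rewrite !cntE -sumrB; apply: eq_bigr => p _ /=; rewrite -/(P p q) ltnNge.
  by case: leqP; case: (P p q); rewrite ?(subrr, subr0).
have T : n%:R * (16 * n%:R * l - 1) <= \sum_(q <- w) (count (P^~ q) v)%:R.
  have -> : n%:R * (16 * n%:R * l - 1) = \sum_(q <- w) (16 * n%:R * l - 1).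
    by rewrite big_const_seq count_predT size_iota iter_addr_0 mulr_natl.
  rewrite [leLHS]big_seq [leRHS]big_seq; apply: ler_sum => q.
  rewrite mem_iota => /andP[q1 q2].
  have Q0 : 16 * n%:R <= q%:R :> R by rewrite -natrM ler_nat.
  apply: le_trans (count_naturals_ge _ _ _); first 1 last.
  - by rewrite mulr_ge0.
  - by rewrite ler_wpM2r// ltW.
  - apply: le_lt_trans (ler_piMl _ b1) _; rewrite ?ler0n// ltr_nat; lia.
  rewrite -mulrBl -/l lerD2r mulrC ler_wpM2l//; exact: ltW.
(* A bad pair is charged to its gcd d, which divides both p and q; the multiples of d in the two
   ranges are then counted independently. *)
have B : \sum_(q <- w) (count (fun p => P p q && (16 <= gcdn p q)%N) v)%:R <=
    \sum_(16 <= d < 17 * n) (n%:R / d%:R + 1) * (17 * n%:R * l / d%:R + 1) :> R.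
  apply: (@le_trans _ _ (\sum_(q <- w) \sum_(16 <= d < 17 * n)
      ((d %| q)%N)%:R * (17 * n%:R * l / d%:R + 1))).
    rewrite [leLHS]big_seq [leRHS]big_seq; apply: ler_sum => q.
    rewrite mem_iota => /andP[q1 q2].
    apply: (@le_trans _ _ (\sum_(16 <= d < 17 * n) ((d %| q)%N)%:R *
        (count (fun p => [&& (d %| p)%N, a * q%:R <= p%:R & p%:R <= b * q%:R]) v)%:R)).
      under eq_bigr do rewrite cntE mulr_sumr.
      rewrite cntE exchange_big/=; apply: ler_sum => p _.
      case: (boolP (P p q && (16 <= gcdn p q)%N)) => [/andP[Ppq g]|_]; last first.
        by apply: sumr_ge0 => d _; rewrite mulr_ge0.
      have gq : (gcdn p q <= q)%N by rewrite dvdn_leq ?dvdn_gcdr//; lia.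
      rewrite (bigD1_seq (gcdn p q)) ?iota_uniq//=; last first.
        by rewrite mem_index_iota g; lia.
      rewrite dvdn_gcdr dvdn_gcdl mul1r -/(P p q) Ppq lerDl.
      by apply: sumr_ge0 => d _; rewrite mulr_ge0.
    apply: ler_sum_nat => d /andP[d1 d2]; apply: ler_wpM2l => //.
    apply: le_trans (count_multiples_le _ _ _) _; first by lia.
      by rewrite ler_wpM2r// ltW.
    rewrite lerD2r ler_wpM2r ?invr_ge0// -mulrBl mulrC ler_wpM2r ?(ltW l0)//.
    by rewrite -natrM ler_nat; lia.
  rewrite exchange_big/=; apply: ler_sum_nat => d /andP[d1 d2].
  rewrite -mulr_suml ler_wpM2r//.
    by rewrite addr_ge0// divr_ge0// mulr_ge0// ?mulr_ge0// ltW.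
  have d0 : (0 < d)%N by exact: leq_trans d1.
  have n1617 : (16 * n)%:R <= (17 * n)%:R :> R by rewrite ler_nat leq_mul2r orbT.
  have := @count_multiples_le R (17 * n) d _ _ d0 n1617.
  have -> : (17 * n)%:R - (16 * n)%:R = n%:R :> R by rewrite !natrM; ring.
  rewrite -cntE; apply: le_trans.
  rewrite ler_nat.
  have -> : (17 * n = 16 * n + n)%N by lia.
  rewrite iotaD add0n count_cat -/w (leq_trans _ (leq_addl _ _))//.
  rewrite -!size_filter; apply: eq_leq; congr size; apply: eq_in_filter => q.
  rewrite mem_iota => /andP[q1 q2]; rewrite !ler_nat q1 (ltnW q2)/= andbT//.
clearbody v w.
have e17 : (17 * n = (17 * n).-1.+1)%N by lia.
have h1 : \sum_(16 <= i < 17 * n) i%:R ^- 2 <= 1 / 15 :> R.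
  have n15 : (15 <= (17 * n).-1)%N by lia.
  rewrite e17; apply: le_trans (@sum_inv_sqr R 15 _ isT n15) _.
  by rewrite gerBl divr_ge0.
have h3 : (17 * n - 16)%:R <= 17 * n%:R :> R by rewrite -natrM ler_nat; lia.
move=> h4; move: B.
rewrite [X in _ <= X -> _](eq_bigr (fun d : nat => 17 * n%:R ^+ 2 * l * (d%:R ^+ 2)^-1 +
    (n%:R + 17 * n%:R * l) * d%:R^-1 + 1)); last first.
  by move=> d _; rewrite -exprVn; ring.
rewrite !big_split/= -!mulr_sumr sumr_const_nat => B.
(* With this parameter the harmonic sum costs 18 n * 17 n l / 200 = 1.53 n^2 l plus the linear term
   3600 n / l. *)
have K0 : 0 < 200 / l by rewrite divr_gt0.
have h2 := @sum_inv_le R (200 / l) 16 (17 * n) K0 isT.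
have X0 : 0 < n%:R :> R by rewrite ltr0n.
have h1' : 17 * n%:R ^+ 2 * l * \sum_(16 <= i < 17 * n) i%:R ^- 2 <= 17 * n%:R ^+ 2 * l * (1 / 15).
  by rewrite ler_wpM2l// mulr_ge0// ?mulr_ge0// ltW.
have l1 : l <= 1 by rewrite /l lerBlDr (le_trans b1)// lerDl.
have h2' : (n%:R + 17 * n%:R * l) * \sum_(16 <= d < 17 * n) d%:R^-1 <=
    18 * n%:R * (200 / l + (17 * n)%:R / (200 / l)).
  apply: ler_pM => //.
  - by rewrite addr_ge0// mulr_ge0// ltW.
  - by apply: sumr_ge0 => d _; rewrite invr_ge0.
  - by have := ler_wpM2l (ltW X0) l1; clear -X0; lra.
have h4' := ler_wpM2l (ltW X0) h4.
have e : (17 * n)%:R / (200 / l) = 17 / 200 * n%:R * l.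
  by rewrite natrM; field; rewrite gt_eqF.
rewrite e !(mulrDr (18 * n%:R)) in h2'.
move: T B h1' h2' h3 h4' X0.
have -> : 18 * n%:R * (200 / l) = n%:R * (3600 / l) by ring.
rewrite [n%:R * (18 + _)]mulrDr.
set Z := n%:R * (3600 / l); set S1 := \sum_(_ <- _) _; set S2 := \sum_(_ <- _) _.
set S3 := _ * l * \sum_(_ <= _ < _) _; set S4 := _ * \sum_(_ <= _ < _) _.
rewrite /= -/l; move: Z S1 S2 S3 S4 (_ - 16)%:R; clear -l0 => Z S1 S2 S3 S4 m.
have : 0 <= l * n%:R ^+ 2 by rewrite mulr_ge0// ltW.
by lra.
Qed.

Lemma many_fractions a b : 0 <= a -> a < b -> b <= 1 ->
  exists n0 : nat, forall n : nat, (n0 <= n)%N ->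
  exists s : seq R, [/\ uniq s, (b - a) * n%:R ^+ 2 <= (size s)%:R &
    forall x, x \in s -> a <= x <= b /\
      exists p q : nat, (16 * n <= q < 17 * n)%N /\ x = p%:R / q%:R].
Proof.
move=> a0 ab b1; have [n0 n0P] := count_good_fractions a0 ab b1.
exists (maxn n0 1) => n; rewrite geq_max => /andP[/n0P cnt n_gt0] {n0 n0P}.
move: cnt; set P := fun z : nat * nat => _; set X := [seq _ | _ <- _, _ <- _] => cnt.
pose f (z : nat * nat) : R := z.1%:R / z.2%:R.
have XP z : z \in X -> (16 * n <= z.2 < 17 * n)%N.
  move=> /allpairsP[[q p]/= [qw _ ->]]; move: qw; rewrite mem_iota/=.
  by clear -n_gt0; lia.
have XP0 z : z \in X -> z.2%:R != 0 :> R.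
  by move/XP => /andP[h _]; rewrite pnatr_eq0 -lt0n (leq_trans _ h)// muln_gt0.
exists [seq f z | z <- X & P z]; split.
- rewrite map_inj_in_uniq.
    by rewrite filter_uniq// allpairs_uniq ?iota_uniq// => -[? ?] [? ?] _ _ [-> ->].
  move=> [p q] [p' q']; rewrite !mem_filter => /andP[/and3P[g _ _] pq] /andP[_ pq'].
  rewrite /f => /eqP; rewrite eqr_div ?(XP0 _ pq) ?(XP0 _ pq')// -!natrM eqr_nat => /eqP e.
  by have /= [-> ->] := frac_inj n_gt0 (XP _ pq) (XP _ pq') g e.
- by rewrite size_map size_filter.
- move=> _ /mapP[z + ->]; rewrite mem_filter => /andP[/and3P[_ h1 h2] zX]; split.
    have z0 : 0 < z.2%:R :> R by rewrite lt0r XP0/=.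
    by rewrite /f ler_pdivlMr// ler_pdivrMr// h1.
  by exists z.1, z.2; split => //; exact: XP.
Qed.
End Fractions.

(** * Packing an interval with balls around fractions of many levels *)

Section Scales.
Context {R : realType}.
Implicit Types (a b x y : R) (k : nat).

(* Level k uses all fractions p/q with q in [16 scale k, 17 scale k), reduced or
   not; distinct ones are at distance at least (17 scale k)^-2 >= 2 rho k. *)
Definition scale k : nat := (100 ^ k)%N.

Definition fraction_at k x : Prop :=
  exists p q : nat, (16 * scale k <= q < 17 * scale k)%N /\ x = p%:R / q%:R.

(** Since log q is comparable to k at level k, the factor 1/k stands for 1/log q and makes the
    contributions of the levels a harmonic series. *)
Definition rho k : R := (2 * (17 * (scale k)%:R) ^+ 2 * k%:R)^-1.

Lemma scale_gt0 k : (0 < scale k)%N.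
Proof. by rewrite expn_gt0. Qed.

Lemma scaleS k : scale k.+1 = (100 * scale k)%N.
Proof. exact: expnS. Qed.

Lemma leq_scale k k' : (k <= k')%N -> (scale k <= scale k')%N.
Proof. by move=> kk; rewrite leq_exp2l. Qed.

Lemma scale_ge k : (k <= scale k)%N.
Proof. by apply: ltnW; apply: ltn_expl. Qed.

Lemma scaleR_gt0 k : 0 < 17 * (scale k)%:R :> R.
Proof. by rewrite mulr_gt0 ?ltr0n// scale_gt0. Qed.

Lemma rho_gt0 k : (0 < k)%N -> 0 < rho k.
Proof.
move=> k0; rewrite /rho invr_gt0; apply: mulr_gt0; last by rewrite ltr0n.
by apply: mulr_gt0; [exact: ltr0Sn | apply: exprn_gt0; exact: scaleR_gt0].
Qed.

Lemma rho_le k k' : (0 < k)%N -> (k <= k')%N -> rho k' <= rho k.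
Proof.
move=> k0 kk; rewrite /rho lef_pV2 ?posrE; last 2 first.
- by rewrite -invr_gt0 rho_gt0// (leq_trans k0).
- by rewrite -invr_gt0 rho_gt0.
have N0 := scaleR_gt0 k; have N0' := scaleR_gt0 k'.
apply: ler_pM; rewrite ?ler_nat//.
apply: ler_wpM2l => //; rewrite ler_pXn2r ?nnegrE// ?(ltW N0)// ?(ltW N0')//.
by rewrite ler_wpM2l// ler_nat leq_scale.
Qed.

Lemma rho_le_inv k : (0 < k)%N -> rho k <= k%:R^-1.
Proof.
move=> k0; have k0' : 0 < k%:R :> R by rewrite ltr0n.
rewrite lef_pV2 ?posrE//; last by rewrite -invr_gt0 rho_gt0.
rewrite ler_peMl// mulr_ege1// ?ler1n// expr_ge1//.
by rewrite -natrM ler1n muln_gt0 scale_gt0.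
Qed.

Lemma fraction_at_sep k k' K x y : (k <= K)%N -> (k' <= K)%N ->
  fraction_at k x -> fraction_at k' y -> x != y ->
  ((17 * (scale K)%:R) ^+ 2)^-1 <= `|x - y|.
Proof.
move=> kK k'K [p [q [/andP[q1 q2] ->]]] [p' [q' [/andP[q1' q2'] ->]]] ne.
have q0 : (0 < q)%N by rewrite (leq_trans _ q1)// muln_gt0 scale_gt0.
have q'0 : (0 < q')%N by rewrite (leq_trans _ q1')// muln_gt0 scale_gt0.
apply: le_trans (frac_separated q0 q'0 ne).
rewrite lef_pV2 ?posrE; last 2 first.
- by rewrite exprn_gt0// scaleR_gt0.
- by apply: mulr_gt0; rewrite ltr0n.
rewrite expr2; apply: ler_pM => //.
  by rewrite -natrM ler_nat (leq_trans (ltnW q2))// leq_mul2l leq_scale.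
by rewrite -natrM ler_nat (leq_trans (ltnW q2'))// leq_mul2l leq_scale.
Qed.

Lemma harmonic_unbounded (K : nat) (B : R) : (0 < K)%N ->
  exists m, B <= \sum_(K <= j < K + m) j%:R^-1.
Proof.
move=> K0; suff H (t : nat) : exists m, t%:R / 2 <= \sum_(K <= j < K + m) j%:R^-1 :> R.
  have [m mP] := H (Num.truncn (2 * B)).+1; exists m; apply: le_trans mP.
  by rewrite ler_pdivlMr// mulrC; apply/ltW/truncnS_gt.
elim: t => [|t [m mP]]; first by exists 0%N; rewrite addn0 big_geq// mul0r.
exists (m + (K + m))%N; rewrite addnA (@big_cat_nat _ _ _ (K + m))/= ?leq_addr//.
rewrite -natr1 mulrDl lerD//.
apply: (@le_trans _ _ (\sum_(K + m <= j < K + m + (K + m)) (2 * (K + m)%:R)^-1)).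
  rewrite sumr_const_nat addnK -[leRHS]mulr_natl invfM mulrCA divff ?mulr1 ?mul1r//.
  by rewrite pnatr_eq0 -lt0n addn_gt0 K0.
apply: ler_sum_nat => j /andP[j1 j2]; rewrite lef_pV2 ?posrE ?mulr_gt0 ?ltr0n ?addn_gt0 ?K0//.
  by rewrite -natrM ler_nat mul2n -addnn ltnW.
by rewrite (leq_trans _ j1)// addn_gt0 K0.
Qed.

Lemma count_not_all (T U : Type) (Q : T -> U -> bool) (s : seq T) (S : seq U) :
  (count (fun u => ~~ all (Q u) S) s <= \sum_(z <- S) count (fun u => ~~ Q u z) s)%N.
Proof.
elim: S => [|z S IH]; first by rewrite big_nil (eq_count (a2 := pred0)) ?count_pred0.
rewrite big_cons; apply: leq_trans (leq_add (leqnn _) IH).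
rewrite -count_predUI; apply: leq_trans (leq_addr _ _).
by apply: sub_count => u /=; rewrite negb_and.
Qed.

Let separated (S : seq (nat * R)) :=
  {in S &, forall z z', z != z' -> rho z.1 + rho z'.1 <= `|z.2 - z'.2|}.

(* Greedy choice level by level: as long as the chosen balls are short in total,
   they spoil only a small part of the ~ |b - a| (scale k)^2 fractions of the
   next level, so each level k contributes a length of order |b - a| / k. *)
Lemma disjoint_fraction_balls a b (K0 : nat) : 0 <= a -> a < b -> b <= 1 ->
  exists S : seq (nat * R), [/\ uniq S,
    forall z, z \in S -> [/\ (K0 <= z.1)%N, (0 < z.1)%N, fraction_at z.1 z.2,
                           a <= z.2 - rho z.1 & z.2 + rho z.1 <= b],
    {in S &, forall z z', z != z' -> rho z.1 + rho z'.1 <= `|z.2 - z'.2|} &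
    (b - a) / (40 * 17 ^+ 2) <= \sum_(z <- S) rho z.1].
Proof.
move=> a0 ab b1; pose l := b - a; have l0 : 0 < l by rewrite subr_gt0.
have [n0 n0P] : exists n0 : nat, forall n : nat, (n0 <= n)%N ->
    exists s : seq R, [/\ uniq s, l / 2 * n%:R ^+ 2 <= (size s)%:R &
    forall x, x \in s -> a + l / 4 <= x <= b - l / 4 /\
      exists p q : nat, (16 * n <= q < 17 * n)%N /\ x = p%:R / q%:R].
  have -> : l / 2 = (b - l / 4) - (a + l / 4) by rewrite /l; field.
  by apply: many_fractions; rewrite /l in l0 *; lra.
pose K1 := maxn (maxn K0 1) (maxn n0 (Num.truncn (20 / l)).+1).
have K1P k : (K1 <= k)%N ->
    [/\ (K0 <= k)%N, (0 < k)%N, (n0 <= scale k)%N, rho k <= l / 4 &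
        20 <= (scale k)%:R ^+ 2 * l].
  rewrite !geq_max => /andP[/andP[K0k k0] /andP[n0k lk]].
  have lk' : 20 <= k%:R * l.
    rewrite -ler_pdivrMr//; apply: ltW; apply: lt_le_trans (truncnS_gt _) _.
    by rewrite ler_nat.
  have N1 : 1 <= (scale k)%:R :> R by rewrite ler1n scale_gt0.
  have Nk : k%:R <= (scale k)%:R :> R by rewrite ler_nat scale_ge.
  have kN2 : k%:R <= (scale k)%:R ^+ 2 :> R by rewrite (le_trans Nk)// expr2 ler_peMl.
  split => //; first by rewrite (leq_trans n0k)// scale_ge.
    have k0' : 0 < k%:R :> R by rewrite ltr0n.
    have := rho_le_inv k0.
    move=> /le_trans; apply; rewrite -[leLHS]mul1r ler_pdivrMr//.
    by move: lk'; rewrite [k%:R * _]mulrC; lra.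
  by apply: le_trans lk' _; rewrite ler_wpM2r// ltW.
(* Each level adds at least (l / 4) (scale k)^2 balls of radius [rho k], that is, length l / (8 *
   17^2 k). Once the harmonic sum reaches 1 this exceeds the target l / (40 * 17^2); the first
   alternative records that the target was reached earlier. *)
suff H m : exists S : seq (nat * R), [/\ uniq S,
    forall z, z \in S -> [/\ (K1 <= z.1 < K1 + m)%N, fraction_at z.1 z.2,
                           a <= z.2 - rho z.1 & z.2 + rho z.1 <= b],
    separated S &
    l / (40 * 17 ^+ 2) <= \sum_(z <- S) rho z.1 \/
    l / (8 * 17 ^+ 2) * \sum_(K1 <= j < K1 + m) j%:R^-1 <= \sum_(z <- S) rho z.1].
  have [_ K10 _ _ _] := K1P _ (leqnn K1).
  have [m mP] := harmonic_unbounded 1 K10.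
  have [S [uS SP sepS sumS]] := H m; exists S; split => //.
    by move=> z /SP[/andP[z1 _] *]; have [? ? _ _ _] := K1P _ z1; split.
  case: sumS => // /(le_trans _); apply.
  apply: le_trans (ler_wpM2l _ mP); last by rewrite divr_ge0// ltW.
  by rewrite mulr1 -/l; move: l0; clear; lra.
elim: m => [|m [S [uS SP sepS sumS]]].
  by exists [::]; split => //; right; rewrite addn0 big_geq// big_nil mulr0.
have [big|small] := leP (l / (40 * 17 ^+ 2)) (\sum_(z <- S) rho z.1).
  exists S; split => //; last by left.
  by move=> z /SP[/andP[z1 z2] *]; split => //; rewrite z1 addnS ltnS ltnW.
case: sumS => [/(lt_le_trans small)|sumS]; first by rewrite ltxx.
set k := (K1 + m)%N; have [K0k k0 n0k rhok Nl] := K1P k (leq_addr _ _).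
have [s [us sizes sP]] := n0P _ n0k.
pose Q x (z : nat * R) := rho z.1 + rho k <= `|z.2 - x|.
exists (S ++ [seq (k, x) | x <- s & all (Q x) S]).
pose T : R := \sum_(z <- S) rho z.1.
have Nk0 := scaleR_gt0 k; pose W : R := (17 * (scale k)%:R) ^+ 2.
have W0 : 0 < W by exact: exprn_gt0.
have SK1 z : z \in S -> [/\ (0 < z.1)%N, (z.1 < k)%N, 0 < rho z.1 & rho k <= rho z.1].
  move=> /SP[/andP[z1 z2] _ _ _]; have [_ z0 _ _ _] := K1P _ z1.
  by split => //; [exact: rho_gt0 | apply: rho_le => //; exact: ltnW].
(* All earlier levels are below k, so the old centres are at least 100^2 / W apart. The ratio 100 in
   [scale] makes their number a small fraction of the new candidates. *)
have sizeS : (size S)%:R <= l * (W / 100 ^+ 2) + 1.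
  have Wp : 0 < W / 100 ^+ 2 by apply: divr_gt0 => //; apply: exprn_gt0.
  rewrite -(size_map snd) -[W / _]invrK -/(_ / _).
  have kS : k = k.-1.+1 by rewrite prednK.
  have sndE : {in S &, forall z z', z != z' -> z.2 != z'.2}.
    move=> z z' zS z'S ne; have := sepS _ _ zS z'S ne.
    have [_ _ r0 _] := SK1 _ zS; have [_ _ r0' _] := SK1 _ z'S.
    by apply: contraTneq => ->; rewrite subrr normr0 -ltNge addr_gt0.
  apply: separated_size.
  - by rewrite invr_gt0.
  - exact: ltW.
  - rewrite map_inj_in_uniq// => z z' zS z'S e.
    by apply/eqP/negPn/negP => /(sndE _ _ zS z'S); rewrite e eqxx.
  - move=> _ /mapP[z zS ->]; have [_ _ r0 _] := SK1 _ zS.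
    by have [_ _] := SP _ zS; move: r0; clear; move=> *; apply/andP; split; lra.
  - move=> _ _ /mapP[z zS ->] /mapP[z' z'S ->] ne.
    have [_ _ _ _] := SP _ zS; have [/andP[_ zk] fz _ _] := SP _ zS.
    have [/andP[_ zk'] fz' _ _] := SP _ z'S.
    apply: le_trans (@fraction_at_sep _ _ k.-1 _ _ _ _ fz fz' ne); last 2 first.
    - by rewrite -ltnS -kS.
    - by rewrite -ltnS -kS.
    rewrite /W kS scaleS natrM /=; rewrite le_eqVlt; apply/orP; left; apply/eqP.
    by congr (_^-1); field.
(* As [rho k <= rho z.1], a candidate spoiled by z lies within [2 * rho z.1] of its centre, and
   candidates are at least 1/W apart. *)
have cnt z : z \in S -> (count (fun x => ~~ Q x z) s)%:R <= 4 * rho z.1 * W + 1.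
  move=> zS; have [_ _ r0 rk] := SK1 _ zS.
  rewrite -size_filter; have -> : 4 * rho z.1 * W =
      ((z.2 + 2 * rho z.1) - (z.2 - 2 * rho z.1)) / W^-1 by rewrite invrK; ring.
  apply: separated_size.
  - by rewrite invr_gt0.
  - by move: r0; clear; lra.
  - exact: filter_uniq.
  - move=> x; rewrite mem_filter -ltNge distrC ltr_distl => /andP[/andP[x1 x2] _].
    by move: rk x1 x2; clear; move=> *; apply/andP; split; lra.
  - move=> x y; rewrite !mem_filter => /andP[_ xs] /andP[_ ys] ne.
    apply: (@fraction_at_sep k k k) => //; [have [_] := sP _ xs | have [_] := sP _ ys].
      by case=> p [q [pq e]]; exists p, q.
    by case=> p [q [pq e]]; exists p, q.
have bad : (count (fun x => ~~ all (Q x) S) s)%:R <= 4 * T * W + (l * (W / 100 ^+ 2) + 1).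
  have := count_not_all Q s S; rewrite -(ler_nat R) natr_sum => /le_trans; apply.
  apply: (@le_trans _ _ (\sum_(z <- S) (4 * rho z.1 * W + 1))).
    by rewrite big_seq [leRHS]big_seq; apply: ler_sum => z; exact: cnt.
  rewrite big_split/= -mulr_suml -mulr_sumr lerD2l.
  by rewrite big_const_seq count_predT iter_addr_0.
(* With N = [scale k], at most (1/10 + 289/10000) l N^2 + 1 of the at least l N^2 / 2 candidates are
   spoiled, and 1 <= l N^2 / 20 by [Nl]. *)
have good : l / 4 * (scale k)%:R ^+ 2 <= (count (fun x => all (Q x) S) s)%:R.
  have e : (count (fun x => all (Q x) S) s)%:R + (count (fun x => ~~ all (Q x) S) s)%:R = (size s)%:R :> R.
    by rewrite -natrD count_predC.
  have TW : 4 * T * W <= 4 * (l / (40 * 17 ^+ 2)) * W.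
    by rewrite ler_wpM2r ?(ltW W0)// ler_wpM2l// ltW.
  move: e bad TW sizes Nl; rewrite /W.
  move: (count _ _)%:R (count _ _)%:R (size s)%:R ((scale k)%:R : R) => u v w N.
  have -> : l * ((17 * N) ^+ 2 / 100 ^+ 2) = 289 / 10000 * (N ^+ 2 * l) by field.
  have -> : 4 * (l / (40 * 17 ^+ 2)) * (17 * N) ^+ 2 = (N ^+ 2 * l) / 10 by field.
  have -> : l / 4 * N ^+ 2 = N ^+ 2 * l / 4 by field.
  have -> : l / 2 * N ^+ 2 = N ^+ 2 * l / 2 by field.
  by move: (N ^+ 2 * l); clear; move=> X; lra.
have memS' z : z \in S ++ [seq (k, x) | x <- s & all (Q x) S] ->
    z \in S \/ [/\ z.1 = k, z.2 \in s & all (Q z.2) S].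
  rewrite mem_cat => /orP[->|/mapP[x + ->]]; first by left.
  by rewrite mem_filter => /andP[? ?]; right.
have QP z z' : z \in S -> all (Q z'.2) S -> rho z.1 + rho k <= `|z.2 - z'.2|.
  by move=> zS /allP/(_ _ zS).
split.
- rewrite cat_uniq uS/= map_inj_uniq ?filter_uniq// ?andbT; last by move=> ? ? [].
  apply/hasPn => _ /mapP[x _ ->]; apply/negP => /SK1[_ /= + _ _].
  by rewrite ltnn.
- move=> z /memS'[zS|[zk zs _]].
    by have [/andP[z1 z2] ? ? ?] := SP _ zS; split => //; rewrite z1 addnS ltnS ltnW.
  have [/andP[az zb] [p [q [pq e]]]] := sP _ zs; rewrite zk; split.
  - by rewrite leq_addr/= addnS ltnS.
  - by exists p, q.
  - by move: rhok az; clear; lra.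
  - by move: rhok zb; clear; lra.
- move=> z z' /memS'[zS|[zk zs zQ]] /memS'[z'S|[z'k z's z'Q]] ne.
  + exact: sepS.
  + by rewrite z'k; apply: QP.
  + by rewrite zk addrC distrC; apply: QP.
  + rewrite zk z'k; have [_ [p [q [pq e]]]] := sP _ zs; have [_ [p' [q' [pq' e']]]] := sP _ z's.
    have ne2 : z.2 != z'.2.
      by apply: contra ne => /eqP e2; rewrite (surjective_pairing z) (surjective_pairing z') zk z'k e2.
    apply: le_trans (@fraction_at_sep k k k _ _ (leqnn _) (leqnn _) _ _ ne2); last 2 first.
    - by exists p, q.
    - by exists p', q'.
    have -> : rho k + rho k = W^-1 * k%:R^-1.
      by rewrite /rho -/W; field; rewrite (gt_eqF W0) pnatr_eq0 -lt0n k0.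
    by rewrite ler_piMr ?invr_ge0 ?(ltW W0)// invf_le1 ?ltr0n// ler1n.
- right; rewrite big_cat/= addnS big_nat_recr/= ?leq_addr// mulrDr lerD//.
  rewrite big_map/= big_const_seq count_predT iter_addr_0 size_filter/= -/k.
  rewrite -[leRHS]mulr_natl; apply: le_trans (ler_wpM2r (ltW (rho_gt0 k0)) good).
  rewrite le_eqVlt; apply/orP; left; apply/eqP; rewrite /rho.
  have k0' : k%:R != 0 :> R by rewrite pnatr_eq0 -lt0n.
  have N0' : (scale k)%:R != 0 :> R by rewrite pnatr_eq0 -lt0n scale_gt0.
  by field; rewrite k0' N0'.
Qed.
End Scales.

(** * Avoiding a countable family of intervals *)

Section Tails.
Context {R : realType}.

Lemma bounded_sum_tail (f : nat -> R) (M e : R) (n1 : nat) :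
  (forall j, 0 <= f j) -> (forall n, \sum_(0 <= j < n) f j <= M) -> 0 < e ->
  exists2 n0, (n1 <= n0)%N & forall n, \sum_(n0 <= j < n) f j <= e.
Proof.
move=> f0 fM e0; apply: contrapT => H.
have H' n0 : (n1 <= n0)%N -> exists2 n, (n0 <= n)%N & e < \sum_(n0 <= j < n) f j.
  move=> n10; apply: contrapT => H'; apply: H; exists n0 => // n.
  rewrite leNgt; apply/negP => en; apply: H'; exists n => //.
  by rewrite leqNgt; apply/negP => nn0; move: en; rewrite big_geq ?(ltnW nn0)// ltNge (ltW e0).
have G t : exists2 n, (n1 <= n)%N & t%:R * e <= \sum_(0 <= j < n) f j.
  elim: t => [|t [n n1n tn]].
    by exists n1 => //; rewrite mul0r; apply: sumr_ge0.
  have [m nm em] := H' _ n1n; exists m; first exact: leq_trans nm.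
  rewrite (@big_cat_nat _ _ _ n)//= -natr1 mulrDl mul1r lerD//; exact: ltW.
have [n _] := G (Num.truncn (M / e)).+1.
move=> /le_trans/(_ (fM n)); rewrite -ler_pdivlMr// leNgt.
by rewrite truncnS_gt.
Qed.

Lemma uniform_index (T : eqType) (S : seq T) (P : nat -> T -> Prop) (n1 : nat) :
  (forall m n z, (m <= n)%N -> P m z -> P n z) ->
  (forall z, z \in S -> exists n, P n z) ->
  exists2 n, (n1 <= n)%N & forall z, z \in S -> P n z.
Proof.
move=> mono; elim: S => [|z S IH] H; first by exists n1.
have [n n1n nP] := IH (fun y yS => H y (mem_behead (s := z :: S) yS)).
have [m mP] := H z (mem_head _ _).
exists (maxn n m); first by rewrite (leq_trans n1n) ?leq_maxl.
move=> y; rewrite inE => /predU1P[->|/nP]; first exact: mono (leq_maxr _ _) mP.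
by apply: mono; rewrite leq_maxl.
Qed.

Lemma positive_lower_bound (d : nat -> R) (n : nat) : (forall j, 0 < d j) ->
  exists2 e, 0 < e & forall j, (j < n)%N -> e <= d j.
Proof.
move=> d0; elim: n => [|n [e e0 eP]]; first by exists 1.
exists (Num.min e (d n)); first by rewrite lt_min e0 d0.
move=> j; rewrite ltnS leq_eqVlt => /predU1P[->|/eP]; first by rewrite ge_min lexx orbT.
by apply: le_trans; rewrite ge_min lexx.
Qed.
End Tails.

(** * The nested-ball game *)

Section Game.
Context {R : realType} (g : R -> R) (r : nat -> R) (k1 : nat) (c2 Cg d1 : R).
Context (r_ok : forall k, (k1 <= k)%N ->
  [/\ 0 < r k, r k <= rho k / 2, r k <= d1 & c2 * rho k <= g (r k)]).
Context (c2_gt0 : 0 < c2) (Cg_gt0 : 0 < Cg).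
Context (g_gt0 : forall d, 0 < d <= d1 -> 0 < g d).
Context (g_inv : forall d D, 0 < d <= d1 -> 0 < D <= d1 -> g d <= g D -> d <= D).
Context (g_ratio : forall d D, 0 < d -> d <= D -> D <= d1 ->
  d <= Cg * (D / g D) * g d).
Context (a d : nat -> R) (M : R).
Context (dP : forall j, 0 < d j <= d1).
Context (sumM : forall n, \sum_(0 <= j < n) g (d j) <= M).

Let meets (j : nat) (u v : R) := (a j <= v) && (u <= a j + d j).
(** One twentieth of the packing constant of [disjoint_fraction_balls]: the two kinds of loss in
    [ball_step] cost at most [5 * c1] each out of [20 * c1]. *)
Let c1 : R := (20 * (40 * 17 ^+ 2))^-1.
Let small u v := forall n, \sum_(0 <= j < n | meets j u v) d j <= c1 * (v - u).

Let d_gt0 j : 0 < d j. Proof. by have /andP[] := dP j. Qed.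
Let gd_gt0 j : 0 < g (d j). Proof. exact: g_gt0. Qed.
Let c1_gt0 : 0 < c1.
Proof. by rewrite invr_gt0; do ! apply: mulr_gt0 => //; apply: exprn_gt0. Qed.

(* The sets [a j, a j + d j] are to be avoided.  A ball of radius rho is lost
   either to a set of comparable length (controlled by the packing and by
   [small u v]), or to the sets much shorter than rho; the latter each meet one
   ball only, and their total weight is a tail of a convergent series. *)
Lemma ball_step u v (K0 : nat) : 0 <= u -> u < v -> v <= 1 -> small u v ->
  exists k x, [/\ (K0 <= k)%N, (k1 <= k)%N, fraction_at k x,
    u <= x - r k & x + r k <= v] /\ small (x - r k) (x + r k) /\
    forall j, (j < K0)%N -> ~~ meets j (x - r k) (x + r k).
Proof.
move=> u0 uv v1 suv; pose l := v - u; have l0 : 0 < l by rewrite subr_gt0.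
pose kap := Num.min 1 (2 * c1 / Cg).
have kap0 : 0 < kap by rewrite lt_min ltr01 divr_gt0// mulr_gt0.
have kap1 : kap <= 1 by rewrite ge_min lexx.
have kapC : Cg * kap <= 2 * c1.
  by rewrite mulrC -ler_pdivlMr// ge_min lexx orbT.
pose eps := kap * c2 * (5 * c1 * l).
have eps0 : 0 < eps by rewrite !mulr_gt0.
have [n0 K0n0 tail] := bounded_sum_tail K0 (fun j => ltW (gd_gt0 j)) sumM eps0.
(* From level K1 on, [rho] is at most every [d j] with j < n0, so meeting one of these finitely many
   sets counts as a loss to a set of comparable length. Only the tail j >= n0 remains for the other
   kind of loss. *)
have [e e0 eP] := positive_lower_bound n0 d_gt0.
pose K1 := (Num.truncn e^-1).+1.
have K1P k : (K1 <= k)%N -> rho k <= e.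
  move=> K1k; have k0 : (0 < k)%N by exact: leq_trans K1k.
  apply: le_trans (rho_le_inv k0) _; rewrite invf_ple ?posrE// ?ltr0n//.
  by apply: ltW; apply: lt_le_trans (truncnS_gt _) _; rewrite ler_nat.
have [S [uS SP sepS sumS]] :=
  disjoint_fraction_balls (maxn K0 (maxn k1 K1)) u0 uv v1.
pose zmeets j (z : nat * R) := meets j (z.2 - r z.1) (z.2 + r z.1).
have SP' z : z \in S -> [/\ (K0 <= z.1)%N, (k1 <= z.1)%N, fraction_at z.1 z.2 &
   [/\ 0 < rho z.1 :> R, rho z.1 <= e, 0 < r z.1 & r z.1 <= rho z.1 / 2]].
  move=> /SP[+ z0 fz _ _]; rewrite !geq_max => /andP[K0z /andP[k1z K1z]].
  have [r0 rr _ _] := r_ok k1z.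
  by split => //; split => //; [exact: rho_gt0 | exact: K1P].
have SPuv z : z \in S -> u <= z.2 - r z.1 /\ z.2 + r z.1 <= v.
  move=> zS; have [_ _ _ uz zv] := SP _ zS; have [_ _ _ [? _ ? ?]] := SP' _ zS.
  by split; lra.
apply: contrapT => noball.
(* A failure of [small] is visible in some finite partial sum; as S is finite, a single n serves for
   all its balls. *)
pose bad n z := has (zmeets^~ z) (iota 0 n0) \/
  c1 * (2 * r z.1) < \sum_(0 <= j < n | zmeets j z) d j.
have [n n0n nP] : exists2 n, (n0 <= n)%N & forall z, z \in S -> bad n z.
  apply: uniform_index => [m n z mn [?|?]|z zS]; first by left.
    right; apply: lt_le_trans; first by eassumption.
    rewrite (@big_cat_nat _ _ _ m 0 n)//= lerDl; apply: sumr_ge0 => j _; exact: ltW.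
  apply: contrapT => nobad; apply: noball; exists z.1, z.2.
  have [? ? ? _] := SP' _ zS; have [? ?] := SPuv _ zS.
  split; first by [].
  split.
    move=> n; rewrite leNgt; apply/negP => H; apply: nobad; exists n; right.
    by move: H; congr (_ < _); congr (_ * _); ring.
  move=> j jK0; apply/negP => mj; apply: nobad; exists 0%N; left.
  by apply/hasP; exists j => //; rewrite mem_iota/= (leq_trans jK0).
pose bad1 z := has (fun j => zmeets j z && (rho z.1 <= 2 * d j)) (iota 0 n).
have c1E : (40 * 17 ^+ 2)^-1 = 20 * c1 by rewrite /c1; move: (40 * _ : R) => A; rewrite invfM mulVKf// gt_eqF.
have dom j : 0 <= d j by exact: ltW.
have S1 : \sum_(z <- S | bad1 z) rho z.1 <= 5 * c1 * l.
  apply: (@le_trans _ _ (\sum_(0 <= j < n | meets j u v) 5 * d j)); last first.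
    by rewrite -mulr_sumr -mulrA ler_wpM2l// suv.
  apply: (@le_trans _ _ (\sum_(z <- S) \sum_(0 <= j < n)
      if zmeets j z && (rho z.1 <= 2 * d j) then rho z.1 else 0)).
    rewrite big_mkcond [leLHS]big_seq [leRHS]big_seq; apply: ler_sum => z zS.
    have [_ _ _ [r0 _ _ _]] := SP' _ zS.
    have nn j : (0 : R) <= (if zmeets j z && (rho z.1 <= 2 * d j) then rho z.1 else 0).
      by case: ifP => // _; exact: ltW.
    case: ifP => [/hasP[j jn jz]|_]; last exact: sumr_ge0.
    rewrite (bigD1_seq j) ?iota_uniq//=; last by rewrite /index_iota subn0.
    by rewrite jz lerDl sumr_ge0.
  rewrite exchange_big/= [leRHS]big_mkcond/=; apply: ler_sum => j _.
  rewrite -big_mkcond/=; case: ifP => [_|/negbT nm]; last first.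
    rewrite big_seq_cond big1// => z /andP[zS /andP[mz _]]; move: nm mz.
    have [uz zv] := SPuv _ zS; rewrite /zmeets /meets => /negP H /andP[m1 m2]; exfalso.
    by apply: H; rewrite (le_trans m1)//= (le_trans uz).
  rewrite -big_filter; set S' := [seq _ <- S | _].
  (* These balls meet the set j and have [rho <= 2 * d j], so they all fit into an interval of
     length [9 * d j]; being disjoint, they have radii of total at most [9/2 * d j]. *)
  have H : \sum_(z <- S') 2 * rho z.1 <= (a j + 5 * d j) - (a j - 4 * d j).
    apply: (disjoint_intervals_sum (x := snd)).
    - exact: filter_uniq.
    - by have := dom j; lra.
    - move=> z; rewrite mem_filter => /andP[/andP[mz rz] zS].
      have [_ _ _ [r0 _ _ rr]] := SP' _ zS; move: mz; rewrite /zmeets /meets => /andP[m1 m2].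
      by split; [exact: ltW | lra | lra].
    - move=> z z'; rewrite !mem_filter => /andP[_ zS] /andP[_ z'S]; exact: sepS.
  by move: H (dom j); rewrite -mulr_sumr; move: (\sum_(_ <- _) _) => X; lra.
have S2 : kap * c2 * \sum_(z <- S | ~~ bad1 z) rho z.1 <= eps.
  apply: (@le_trans _ _ (\sum_(n0 <= j < n) g (d j))); last exact: tail.
  (* Two centres are at least rho + rho' apart, the shrunken radii are at most rho/2 and rho'/2, and
     the set is shorter than both halves, so it cannot meet two of the shrunken balls. *)
  have one j : \sum_(z <- S | ~~ bad1 z) (if zmeets j z then g (d j) else 0) <=
      if (j < n)%N then g (d j) else \sum_(z <- S | ~~ bad1 z) (if zmeets j z then g (d j) else 0).
    case: ifP => // jn; rewrite -big_mkcondr/= -big_filter.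
    have uf := filter_uniq (fun z => ~~ bad1 z && zmeets j z) uS.
    have mf z : z \in [seq z <- S | ~~ bad1 z && zmeets j z] ->
        [/\ z \in S, zmeets j z & 2 * d j < rho z.1].
      rewrite mem_filter => /andP[/andP[nb mz] zS]; split => //.
      rewrite ltNge; apply/negP => rz; move/negP: nb; apply; apply/hasP.
      by exists j; rewrite ?mem_iota// mz.
    move: uf mf; case: [seq _ <- S | _] => [|z [|z' s]] /= uf mf.
    - by rewrite big_nil ltW.
    - by rewrite big_seq1.
    - have [zS mz rz] := mf z (mem_head _ _).
      have [z'S mz' rz'] : [/\ z' \in S, zmeets j z' & 2 * d j < rho z'.1].
        by apply: mf; rewrite !inE eqxx orbT.
      have zz' : z != z' by move: uf; rewrite inE negb_or => /andP[/andP[]].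
      have := sepS _ _ zS z'S zz'.
      have [_ _ _ [r0 _ _ rr]] := SP' _ zS; have [_ _ _ [r0' _ _ rr']] := SP' _ z'S.
      move: mz mz'; rewrite /zmeets /meets => /andP[m1 m2] /andP[m1' m2'].
      by case: ler0P; lra.
  apply: (@le_trans _ _ (\sum_(n0 <= j < n) \sum_(z <- S | ~~ bad1 z) (if zmeets j z then g (d j) else 0))).
    rewrite mulr_sumr exchange_big/= [leLHS]big_seq_cond [leRHS]big_seq_cond.
    apply: ler_sum => z /andP[zS nb].
    have [K0z k1z _ [r0 re rz rr]] := SP' _ zS; have [_ _ rd gr] := r_ok k1z.
    rewrite -big_mkcond/= leNgt; apply/negP => few.
    have few' : \sum_(n0 <= j < n | zmeets j z) g (d j) <= kap * g (r z.1).
      apply: le_trans (ltW few) _; rewrite -mulrA ler_wpM2l//; exact: ltW.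
    have nom j : (j < n0)%N -> ~~ zmeets j z.
      move=> jn0; apply/negP => mz; move/negP: nb; apply; apply/hasP; exists j.
        by rewrite mem_iota/= (leq_trans jn0).
      rewrite mz/=; apply: le_trans re _; apply: le_trans (eP _ jn0) _.
      by have := dom j; lra.
    have [/hasP[j]|] := nP _ zS.
      by rewrite mem_iota/= add0n => /nom /negP.
    apply/negP; rewrite -leNgt (@big_cat_nat _ _ _ n0 0 n)//= big_nat_cond big1; last first.
      by move=> j /andP[/nom/negP].
    rewrite add0r.
    have gr0 : 0 < g (r z.1) by apply: g_gt0; rewrite rz rd.
    apply: (@le_trans _ _ (\sum_(n0 <= j < n | zmeets j z) Cg * (r z.1 / g (r z.1)) * g (d j))).
      rewrite [leLHS]big_seq_cond [leRHS]big_seq_cond; apply: ler_sum => j /andP[jn mj].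
      apply: g_ratio => //; apply: g_inv => //; first by rewrite rz.
      have : g (d j) <= kap * g (r z.1).
        apply: le_trans few'; rewrite -big_filter.
        rewrite (bigD1_seq j) ?filter_uniq ?iota_uniq ?mem_filter ?mj//= lerDl.
        by apply: sumr_ge0 => i _; exact: ltW.
      move=> /le_trans; apply; rewrite ger_pMl//.
    rewrite -mulr_sumr.
    apply: (@le_trans _ _ (Cg * (r z.1 / g (r z.1)) * (kap * g (r z.1)))).
      by rewrite ler_wpM2l// mulr_ge0 ?(ltW Cg_gt0)// divr_ge0// ltW.
    have -> : Cg * (r z.1 / g (r z.1)) * (kap * g (r z.1)) = (Cg * kap) * r z.1.
      by field; rewrite gt_eqF.
    by rewrite [c1 * _]mulrA [c1 * 2]mulrC ler_wpM2r// ltW.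
  rewrite big_nat_cond [leRHS]big_nat_cond; apply: ler_sum => j /andP[/andP[_ jn] _].
  by have := one j; rewrite jn.
have S2' : \sum_(z <- S | ~~ bad1 z) rho z.1 <= 5 * c1 * l.
  by move: S2; rewrite /eps ler_pM2l// mulr_gt0.
move: sumS; rewrite (bigID bad1)/= c1E -/l => sumS.
have : 0 < c1 * l by rewrite mulr_gt0.
by move: S1 S2' sumS; rewrite -!mulrA; lra.
Qed.

(** Stage n plays [ball_step] with K0 = n. The levels are thus unbounded, the set j is avoided once
    stage j + 1 has been played, and the limit point lies in all the closed intervals. *)
Lemma escape : small 0 1 ->
  exists x, (forall K, exists k y, [/\ (K <= k)%N, fraction_at k y & `|x - y| <= r k]) /\
    forall j, ~ (a j <= x <= a j + d j).
Proof.
move=> s01.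
pose T := {p : R * R | [/\ 0 <= p.1, p.1 < p.2, p.2 <= 1 & small p.1 p.2]}.
have stepT (z : nat * T) : exists p : T, exists k y,
    [/\ (z.1 <= k)%N, fraction_at k y, (sval p).1 = y - r k & (sval p).2 = y + r k] /\
    [/\ (sval z.2).1 <= (sval p).1, (sval p).2 <= (sval z.2).2 &
     forall j, (j < z.1)%N -> ~~ meets j (sval p).1 (sval p).2].
  case: z => K [[u v] /= [u0 uv v1 suv]].
  have [k [x [[Kk k1k fx ux xv] [sx nx]]]] := ball_step K u0 uv v1 suv.
  have [rk0 _ _ _] := r_ok k1k.
  have P : [/\ 0 <= (x - r k, x + r k).1, (x - r k, x + r k).1 < (x - r k, x + r k).2,
     (x - r k, x + r k).2 <= 1 & small (x - r k, x + r k).1 (x - r k, x + r k).2].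
    by split => //=; lra.
  by exists (exist _ (x - r k, x + r k) P), k, x.
have [f fP] := choice stepT.
pose p0 : R * R := (0, 1).
have P0 : [/\ 0 <= p0.1, p0.1 < p0.2, p0.2 <= 1 & small p0.1 p0.2] by split => /=.
pose F := fix F n : T := if n is m.+1 then f (m, F m) else exist _ p0 P0.
pose u n := (sval (F n)).1; pose v n := (sval (F n)).2.
have uv n : u n < v n by have [] := svalP (F n).
have nest n m : (n <= m)%N -> u n <= u m /\ v m <= v n.
  elim: m => [|m IH]; first by rewrite leqn0 => /eqP ->.
  rewrite leq_eqVlt => /predU1P[->|]; first by split.
  rewrite ltnS => /IH[h1 h2]; have [k [y [_ /= [h3 h4 _]]]] := fP (m, F m).
  by split; [exact: le_trans h3 | exact: le_trans h2].
have ule n m : u n <= v m.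
  have [nm|/ltnW mn] := leqP n m.
    by have [h _] := nest _ _ nm; exact/(le_trans h)/ltW.
  by have [_ h] := nest _ _ mn; apply: le_trans h; exact: ltW.
pose x := sup (range u); exists x.
have ux n : u n <= x.
  by apply: ub_le_sup; [exists (v 0%N) => _ [m _ <-] | exists n].
have xv n : x <= v n by apply: ge_sup; [exists (u 0%N), 0%N | move=> _ [m _ <-]].
split=> [K|j].
  have [k [y [[Kk fy uy vy] _]]] := fP (K, F K).
  exists k, y; split => //; rewrite ler_distl -[y - _]uy -[y + _]vy.
  by rewrite (ux K.+1) (xv K.+1).
have [k [y [_ [_ _ nj]]]] := fP (j.+1, F j.+1).
move=> /andP[h1 h2]; move/negP: (nj j (ltnSn j)); apply; apply/andP; split.
  exact: le_trans h1 (xv j.+2).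
exact: le_trans (ux j.+2) h2.
Qed.
End Game.

(** * The gauge functions *)

Section Gauge.
Context {R : realType}.
Implicit Types (p kappa d D w x : R).

Lemma powR_expR x p : 0 < x -> x `^ p = expR (p * ln x).
Proof. by move=> x0; rewrite /powR gt_eqF. Qed.

Lemma poly_le_exp (C B e : R) : 0 < C -> 0 < e ->
  exists K : nat, forall k : nat, (K <= k)%N -> C * k%:R `^ B <= expR (e * k%:R).
Proof.
move=> C0 e0.
pose B1 := Num.max B 1; have B10 : 0 < B1 by rewrite lt_max ltr01 orbT.
pose h := e / 2 / B1; have h0 : 0 < h by rewrite !divr_gt0.
pose b := (ln C + B1 * (- ln h)) / (e / 2).
exists (maxn 1 (Num.truncn b).+1) => k; rewrite geq_max => /andP[k1 bk].
have k0 : 0 < k%:R :> R by rewrite ltr0n.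
have bk' : b < k%:R by apply: lt_le_trans (truncnS_gt _) _; rewrite ler_nat.
rewrite powR_expR// -{1}(lnK C0) -expRD ler_expR.
have lnk : 0 <= ln k%:R :> R by rewrite ln_ge0// ler1n.
have Bk : B * ln k%:R <= B1 * ln k%:R by rewrite ler_wpM2r// le_max lexx.
have lk : ln k%:R <= h * k%:R - ln h.
  have := ln_sublinear (mulr_gt0 h0 k0); rewrite lnM ?posrE//; lra.
have := ler_wpM2l (ltW B10) lk.
have -> : B1 * (h * k%:R - ln h) = e / 2 * k%:R - B1 * ln h.
  by rewrite /h mulrBr; congr (_ - _); field; rewrite gt_eqF.
move: bk'; rewrite /b ltr_pdivrMr ?divr_gt0// => bk'.
lra.
Qed.

Definition gauge p kappa d : R := d `^ p * (ln (1 / d)) `^ kappa.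

Lemma ln_inv_gt0 d : 0 < d < 1 -> 0 < ln (1 / d).
Proof. by move=> /andP[d0 d1]; rewrite ln_gt0// ltr_pdivlMr// mul1r. Qed.

Lemma gauge_gt0 p kappa d : 0 < d < 1 -> 0 < gauge p kappa d.
Proof.
move=> dd; have /andP[d0 d1] := dd.
by rewrite /gauge mulr_gt0// powR_gt0// ln_inv_gt0.
Qed.

Lemma powR_le_neg kappa x y : kappa <= 0 -> 0 < x -> x <= y -> y `^ kappa <= x `^ kappa.
Proof.
move=> k0 x0 xy; rewrite !powR_expR// ?(lt_le_trans x0)// ler_expR.
by rewrite ler_wnM2l// ler_ln ?posrE// (lt_le_trans x0).
Qed.

Lemma gauge_lt p kappa d D : 0 < p -> kappa <= 0 -> 0 < d -> d < D -> D < 1 ->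
  gauge p kappa d < gauge p kappa D.
Proof.
move=> p0 k0 d0 dD D1.
have D0 : 0 < D by exact: lt_trans dD.
have d1 : d < 1 by exact: lt_trans D1.
apply: (@le_lt_trans _ _ (d `^ p * (ln (1 / D)) `^ kappa)).
  rewrite ler_wpM2l ?powR_ge0//; apply: powR_le_neg => //.
    by apply: ln_inv_gt0; rewrite D0.
  by rewrite ler_ln ?posrE ?divr_gt0// !mul1r lef_pV2 ?posrE// ltW.
rewrite ltr_pM2r; last by apply: powR_gt0; apply: ln_inv_gt0; rewrite D0.
by apply: gt0_ltr_powR; rewrite ?nnegrE ?ltW.
Qed.

Lemma gauge_inv p kappa d D : 0 < p -> kappa <= 0 -> 0 < d < 1 -> 0 < D < 1 ->
  gauge p kappa d <= gauge p kappa D -> d <= D.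
Proof.
move=> p0 k0 /andP[d0 d1] /andP[D0 D1]; rewrite leNgt => /negP H.
by rewrite leNgt; apply/negP => Dd; apply: H; exact: gauge_lt.
Qed.

(** The quotient d / gauge d = d^(1-p) (log(1/d))^(-kappa) is only almost increasing, because the
    logarithm grows as d shrinks. With D = d e^w its growth is at most the factor (1 + w)^(-kappa),
    which e^((1-p) w) absorbs up to a constant. *)
Lemma gauge_ratio p kappa : p < 1 -> kappa < 0 ->
  exists2 C : R, 0 < C & forall d D, 0 < d -> d <= D -> D <= expR (- 1) ->
   d <= C * (D / gauge p kappa D) * gauge p kappa d.
Proof.
move=> p1 k0; have [be be0 ->] : exists2 be : R, 0 < be & kappa = - be.
  by exists (- kappa); rewrite ?oppr_gt0 ?opprK.
pose al := 1 - p; have al0 : 0 < al by rewrite subr_gt0.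
pose ga := al / be; have ga0 : 0 < ga by rewrite divr_gt0.
(* Chosen for [1 + w <= c * (1 + ga * w) <= c * expR (ga * w)]; the power [be] then turns [ga] into
   [al]. *)
pose c := Num.max 1 ga^-1; have c1 : 1 <= c by rewrite le_max lexx.
have c0 : 0 < c by exact: lt_le_trans c1.
exists (c `^ be); first exact: powR_gt0.
move=> d D d0 dD De; have D0 : 0 < D by exact: lt_le_trans dD.
have e1 : expR (- 1) < 1 :> R by rewrite expR_lt1.
have D1 : D < 1 by exact: le_lt_trans e1.
have d1 : d < 1 by exact: le_lt_trans dD D1.
pose w := ln D - ln d; have w0 : 0 <= w by rewrite subr_ge0 ler_ln.
have lni x : 0 < x -> ln (1 / x) = - ln x by move=> x0; rewrite mul1r lnV.
pose L := - ln D; have L1 : 1 <= L.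
  by rewrite /L lerNr -ler_expR lnK.
have L0 : 0 < L by exact: lt_le_trans L1.
have Lw0 : 0 < L + w by rewrite ltr_wpDr.
rewrite /gauge !lni// (_ : - ln d = L + w); last by rewrite /L /w; ring.
rewrite -/L !powRN.
have key : (L + w) `^ be <= L `^ be * (c `^ be * expR (al * w)).
  apply: (@le_trans _ _ ((L * (1 + w)) `^ be)).
    apply: ge0_ler_powR; rewrite ?nnegrE ?(ltW be0) ?(ltW Lw0)//.
      by rewrite mulr_ge0 ?(ltW L0)// addr_ge0.
    by rewrite mulrDr mulr1 lerD2l ler_peMl.
  have w1 : 0 <= 1 + w by rewrite addr_ge0.
  rewrite (powRM _ (ltW L0) w1); apply: ler_wpM2l; first exact: powR_ge0.
  have -> : expR (al * w) = (expR (ga * w)) `^ be.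
    by rewrite powR_expR ?expR_gt0// expRK /ga mulrA [be * _]mulrC divfK ?gt_eqF.
  rewrite -powRM ?expR_ge0 ?(ltW c0)//.
  apply: ge0_ler_powR; rewrite ?nnegrE ?(ltW be0) ?w1//.
    by rewrite mulr_ge0 ?expR_ge0 ?(ltW c0).
  apply: (@le_trans _ _ (c * (1 + ga * w))); last first.
    by rewrite ler_wpM2l ?(ltW c0)// expR_ge1Dx.
  rewrite mulrDr mulr1 lerD// mulrA ler_peMl//.
  by rewrite -ler_pdivrMr// mul1r le_max lexx orbT.
have DE : D = d * expR w by rewrite /w expRD expRN !lnK ?posrE// mulrCA divff ?gt_eqF// mulr1.
have DpE : D `^ p = d `^ p * expR (p * w).
  by rewrite !powR_expR// -expRD; congr expR; rewrite /w; ring.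
have ap : 0 < d `^ p by exact: powR_gt0.
have X0 : 0 < L `^ be by exact: powR_gt0.
have Y0 : 0 < (L + w) `^ be by exact: powR_gt0.
have P0 : 0 < expR (p * w) by exact: expR_gt0.
have ee : expR w = expR (p * w) * expR (al * w).
  by rewrite -expRD; congr expR; rewrite /al; ring.
rewrite DpE {1}DE ee.
have -> : c `^ be * (d * (expR (p * w) * expR (al * w)) /
   (d `^ p * expR (p * w) / L `^ be)) * (d `^ p / (L + w) `^ be) =
   d * ((L `^ be * (c `^ be * expR (al * w))) / (L + w) `^ be).
  by field; rewrite !gt_eqF.
by rewrite ler_peMr ?(ltW d0)// ler_pdivlMr// mul1r.
Qed.

(** Apply [gauge_ratio] with an exponent p' midway between p and 1 and with D fixed; returning from
    p' to p gains the factor d^(p'-p), which tends to 0. *)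
Lemma gauge_dominates p kappa : 0 < p -> p < 1 -> kappa < 0 ->
  forall eta : R, 0 < eta -> exists2 delta : R, 0 < delta &
    forall d, 0 < d <= delta -> d <= eta * gauge p kappa d.
Proof.
move=> p0 p1 k0 eta eta0; pose p' := (1 + p) / 2.
have p'1 : p' < 1 by rewrite /p'; lra.
have [C C0 CP] := gauge_ratio p'1 k0.
pose D0 : R := expR (- 1); have D00 : 0 < D0 by exact: expR_gt0.
have D01 : 0 < D0 < 1 by rewrite D00 /D0 expR_lt1 ltrN10.
pose A := C * (D0 / gauge p' kappa D0).
have A0 : 0 < A by rewrite mulr_gt0// divr_gt0// gauge_gt0.
pose q := (1 - p) / 2; have q0 : 0 < q by rewrite /q; lra.
exists (Num.min D0 ((eta / A) `^ q^-1)).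
  by rewrite lt_min D00 powR_gt0// divr_gt0.
move=> d; rewrite le_min => /andP[d0 /andP[dD dd]].
apply: le_trans (CP d D0 d0 dD (lexx _)) _; rewrite -/A.
have -> : gauge p' kappa d = d `^ q * gauge p kappa d.
  rewrite /gauge mulrA -powRD; last by rewrite (gt_eqF d0) implybT.
  by congr (_ `^ _ * _); rewrite /p' /q; field.
rewrite mulrA ler_wpM2r//.
  by apply/ltW/gauge_gt0; rewrite d0 (le_lt_trans dD)//; have /andP[] := D01.
rewrite mulrC -ler_pdivlMr//.
have -> : eta / A = ((eta / A) `^ q^-1) `^ q.
  by rewrite -powRrM mulVf ?gt_eqF// powRr1// divr_ge0// ltW.
by apply: ge0_ler_powR; rewrite ?nnegrE ?powR_ge0 ?(ltW q0) ?(ltW d0).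
Qed.

End Gauge.

(** * The well approximable points and their escape from light families *)

Section WellApproximable.
Context {R : realType} (tau kappa : R).
Context (htau : 2 < tau) (hkappa : kappa <= -1).

(** The power of k is the one that makes the gauge of the radius comparable to [rho k]. Since 17 *
    [scale k] exceeds every denominator of level k, for kappa = -1 the radius is at most q^(-tau)
    without any constant. *)
Definition radius (k : nat) : R :=
  (17 * (scale k)%:R) `^ (- tau) * k%:R `^ (- (kappa + 1) * tau / 2).

Let tau_gt0 : 0 < tau. Proof. by apply: lt_trans htau. Qed.
Let b := - (kappa + 1) * tau / 2.
Let b_ge0 : 0 <= b.
Proof. by rewrite /b divr_ge0// mulr_ge0// ?(ltW tau_gt0)// oppr_ge0 -lerBrDr sub0r. Qed.
Let kappa_lt0 : kappa < 0. Proof. by apply: le_lt_trans hkappa _; rewrite ltrN10. Qed.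
Let p_gt0 : 0 < 2 / tau. Proof. by rewrite divr_gt0. Qed.
Let p_lt1 : 2 / tau < 1. Proof. by rewrite ltr_pdivrMr// mul1r. Qed.

Lemma radius_gt0 k : (0 < k)%N -> 0 < radius k.
Proof. by move=> k0; rewrite mulr_gt0// powR_gt0 ?scaleR_gt0// ltr0n. Qed.

Lemma radius_le : exists k1 : nat, forall k, (k1 <= k)%N ->
  (0 < k)%N /\ radius k <= rho k / 2.
Proof.
have ln100 : 0 < ln 100%:R :> R by rewrite ln_gt0// ltr1n.
have t2 : 0 < tau - 2 by rewrite subr_gt0.
have [K KP] := @poly_le_exp R 4 (b + 1) ((tau - 2) * ln 100%:R) ltac:(lra) (mulr_gt0 t2 ln100).
exists (maxn 1 K) => k; rewrite geq_max => /andP[k0 Kk]; split=> //.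
have V0 := @scaleR_gt0 R k; have k0' : 0 < k%:R :> R by rewrite ltr0n.
have -> : rho k / 2 = 1 / (4 * (17 * (scale k)%:R) ^+ 2 * k%:R) :> R.
  rewrite /rho; field.
  by rewrite pnatr_eq0 -lt0n k0 pnatr_eq0 -lt0n scale_gt0.
rewrite /radius -/b; move: (KP k Kk).
have -> : expR ((tau - 2) * ln 100 * k%:R) = (scale k)%:R `^ (tau - 2) :> R.
  rewrite powR_expR ?ltr0n ?scale_gt0// /scale natrX -powR_mulrn// ln_powR.
  by congr expR; ring.
move=> h.
have {h} : 4 * k%:R `^ (b + 1) <= (17 * (scale k)%:R) `^ (tau - 2).
  apply: le_trans h _; apply: ge0_ler_powR; rewrite ?nnegrE ?(ltW t2) ?(ltW V0)//.
  by rewrite ler_peMl// ler1n.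
set V := 17 * _ in V0 *.
rewrite powRD ?(gt_eqF V0) ?implybT// powR_invn ?(ltW V0)//.
rewrite powRD ?(gt_eqF k0') ?implybT// powRr1 ?(ltW k0')//.
have A0 : 0 < V `^ tau by exact: powR_gt0.
rewrite powRN => h; rewrite ler_pdivlMr; last by rewrite mulr_gt0// mulr_gt0// exprn_gt0.
rewrite ler_pdivlMr ?exprn_gt0// in h.
have -> : (V `^ tau)^-1 * k%:R `^ b * (4 * V ^+ 2 * k%:R) =
  (4 * (k%:R `^ b * k%:R) * V ^+ 2) / V `^ tau.
  by field; rewrite gt_eqF.
by rewrite ler_pdivrMr// mul1r.
Qed.

Lemma radius_gauge : exists2 c2 : R, 0 < c2 &
  forall k, (0 < k)%N -> radius k < 1 ->
    c2 * rho k <= gauge (2 / tau) kappa (radius k).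
Proof.
(* For k >= 1 this gives 17 * 100^k <= A^k, so log(1/r) is at most linear in k without an additive
   constant; as kappa < 0, an upper bound of the logarithm bounds the gauge from below. *)
pose A : R := 17 * 100; have A1 : 1 < A by rewrite /A; lra.
have L0 : 0 < ln A by rewrite ln_gt0.
pose c := (tau * ln A) `^ kappa.
have c0 : 0 < c by rewrite powR_gt0// mulr_gt0.
exists (2 * c); first by rewrite mulr_gt0.
move=> k k0 r1; have V0 := @scaleR_gt0 R k.
have k0' : 0 < k%:R :> R by rewrite ltr0n.
have r0 := radius_gt0 k0.
have lnr : ln (1 / radius k) <= tau * ln A * k%:R.
  rewrite mul1r lnV ?posrE// /radius lnM ?posrE ?powR_gt0// !ln_powR -/b.
  have lnk : 0 <= b * ln k%:R by rewrite mulr_ge0// ln_ge0// ler1n.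
  have : ln (17 * (scale k)%:R) <= ln A * k%:R :> R.
    have A0 : 0 < A by exact: lt_trans A1.
    rewrite -ler_expR lnK ?posrE// [_ * k%:R]mulrC -powR_expR//.
    rewrite powR_mulrn ?(ltW A0)// /A exprMn /scale natrX ler_wpM2r ?exprn_ge0//.
    by rewrite -[leLHS]expr1 ler_eXn2l// ltr1n.
  move=> /(ler_wpM2l (ltW tau_gt0)); lra.
have H : (tau * ln A * k%:R) `^ kappa <= (ln (1 / radius k)) `^ kappa.
  by apply: powR_le_neg => //; [exact: ltW | apply: ln_inv_gt0; rewrite r0].
have E : radius k `^ (2 / tau) = ((17 * (scale k)%:R) ^+ 2)^-1 * k%:R `^ (- (kappa + 1)).
  rewrite /radius powRM ?powR_ge0// -!powRrM; congr (_ * _).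
    have -> : - tau * (2 / tau) = - 2%:R by field; rewrite gt_eqF.
    by rewrite powR_invn// ltW.
  by congr (_ `^ _); field; rewrite gt_eqF.
apply: (@le_trans _ _ (radius k `^ (2 / tau) * (tau * ln A * k%:R) `^ kappa)); last first.
  by rewrite /gauge ler_wpM2l// powR_ge0.
rewrite E powRM ?(ltW k0')//; last by rewrite mulr_ge0// ltW.
have -> : k%:R `^ (- (kappa + 1)) = (k%:R `^ kappa)^-1 / k%:R :> R.
  rewrite opprD powRD ?(gt_eqF k0') ?implybT// powRN powRN powRr1//; exact: ltW.
rewrite -/c le_eqVlt; apply/orP; left; apply/eqP; rewrite /rho.
have kk : k%:R `^ kappa != 0 :> R by rewrite gt_eqF// powR_gt0.
move: kk V0; set V := 17 * _; set W := _ `^ kappa => kk V0.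
by field; rewrite kk !gt_eqF.
Qed.

Definition well_approximable : set R :=
  [set x | forall K, exists k y,
    [/\ (K <= k)%N, fraction_at k y & `|x - y| <= radius k]].

(** The bound [delta] is fixed before the sets are given, which is what a statement about all fine
    covers needs. Below it a length is at most c1 / max M 1 times its weight, so the game can start
    on [0, 1]. *)
Lemma well_approximable_escape (M : R) : exists2 delta : R, 0 < delta &
  forall a d : nat -> R, (forall j, 0 < d j <= delta) ->
    (forall n, \sum_(0 <= j < n) gauge (2 / tau) kappa (d j) <= M) ->
  exists2 x, well_approximable x & forall j, ~ (a j <= x <= a j + d j).
Proof.
have M0 : 0 < Num.max M 1 by rewrite lt_max ltr01 orbT.
have [C C0 CP] := gauge_ratio p_lt1 kappa_lt0.
have [k1 k1P] := radius_le; have [c2 c20 c2P] := radius_gauge.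
pose d1 : R := expR (- 1); have d10 : 0 < d1 by exact: expR_gt0.
have d11 : d1 < 1 by rewrite /d1 expR_lt1 ltrN10.
pose c1 : R := (20 * (40 * 17 ^+ 2))^-1.
have c10 : 0 < c1 by rewrite invr_gt0; do ! apply: mulr_gt0 => //; apply: exprn_gt0.
have [delta delta0 deltaP] := gauge_dominates p_gt0 p_lt1 kappa_lt0 (divr_gt0 c10 M0).
exists (Num.min delta d1); first by rewrite lt_min delta0.
move=> a d dP sumM.
pose k2 := maxn k1 (Num.truncn d1^-1).+1.
have k2P k : (k2 <= k)%N -> [/\ 0 < radius k, radius k <= rho k / 2,
    radius k <= d1 & c2 * rho k <= gauge (2 / tau) kappa (radius k)].
  rewrite geq_max => /andP[/k1P[k0 rk] dk].
  have k0' : 0 < k%:R :> R by rewrite ltr0n.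
  have rd : radius k <= d1.
    have kd : k%:R^-1 <= d1.
      rewrite invf_ple ?posrE//; apply: ltW; apply: lt_le_trans (truncnS_gt _) _.
      by rewrite ler_nat.
    apply: le_trans rk _; apply: le_trans kd.
    have := @rho_le_inv R _ k0; have := @rho_gt0 R _ k0; lra.
  split => //; first exact: radius_gt0.
  by apply: c2P => //; exact: le_lt_trans d11.
have dd j : 0 < d j <= d1.
  by have := dP j; rewrite le_min => /andP[-> /andP[_ ->]].
have lt1 x : 0 < x <= d1 -> 0 < x < 1.
  by move=> /andP[-> h]; exact: le_lt_trans d11.
have [|x [wx nx]] := escape k2P c20 C0 (fun x h => gauge_gt0 _ _ (lt1 x h))
  (fun x y hx hy => gauge_inv p_gt0 (ltW kappa_lt0) (lt1 x hx) (lt1 y hy)) CP dd sumM (a := a).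
  move=> n; rewrite subr0 mulr1 -/c1.
  apply: (@le_trans _ _ (\sum_(0 <= j < n) c1 / Num.max M 1 * gauge (2 / tau) kappa (d j))).
    rewrite big_mkcond/=; apply: ler_sum => j _.
    have /andP[dj0] := dP j; rewrite le_min => /andP[djd _].
    have := deltaP (d j); rewrite dj0 => /(_ djd) h; case: ifP => // _.
    exact/ltW/(lt_le_trans dj0).
  rewrite -mulr_sumr mulrAC -mulrA -[leRHS]mulr1 ler_wpM2l ?(ltW c10)//.
  by rewrite ler_pdivrMr// mul1r (le_trans (sumM n))// le_max lexx.
by exists x.
Qed.

End WellApproximable.

(** * Hausdorff measures *)

Section Hausdorff.
Context {R : realType}.
Implicit Types (h : R -> R) (A N : set R).

Lemma nneseries_le (f : nat -> R) (B : R) : (forall i, 0 <= f i) ->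
  (forall n, \sum_(0 <= i < n) f i <= B) ->
  (\sum_(0 <= i <oo) (f i)%:E <= B%:E)%E.
Proof.
move=> f0 fB; apply: lime_le.
  by apply: is_cvg_nneseries => n _ _; rewrite lee_fin.
by apply: nearW => n; rewrite sumEFin lee_fin.
Qed.

Lemma nneseries_ge_sum (f : nat -> R) (B : R) : (forall i, 0 <= f i) ->
  (\sum_(0 <= i <oo) (f i)%:E <= B%:E)%E ->
  forall n, \sum_(0 <= i < n) f i <= B.
Proof.
move=> f0 fB n; rewrite -lee_fin -sumEFin; apply: le_trans fB.
by apply: nneseries_lim_ge => i _ _; rewrite lee_fin.
Qed.

Lemma fine_diam_ge0 (U : set R) : 0 <= fine (diam U).
Proof.
have [->|/set0P[x Ux]] := eqVneq U set0.
  by rewrite /diam set0X image_set0 ereal_sup0.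
apply: fine_ge0; apply: ereal_sup_ubound; exists (x, x) => //=.
by rewrite subrr normr0.
Qed.

Lemma diam_itv (a d : R) : 0 < d -> diam [set x | a <= x <= a + d] = d%:E.
Proof.
move=> d0; apply/eqP; rewrite eq_le; apply/andP; split.
  apply: ge_ereal_sup => _ [[x y] /= [/andP[x1 x2] /andP[y1 y2]] <-].
  by rewrite lee_fin ler_norml; apply/andP; split; lra.
apply: ereal_sup_ubound; exists (a + d, a) => /=.
  by rewrite !lexx lerDl ltW.
by rewrite addrAC subrr add0r gtr0_norm.
Qed.

Lemma hausdorff_content_ge0 h delta A : dimension_function h ->
  (0 <= hausdorff_content h delta A)%E.
Proof.
move=> [h0 hmono _]; apply: le_ereal_inf_tmp => _ [U _ <-].
apply: nneseries_ge0 => i _ _; rewrite lee_fin -h0 hmono//.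
exact: fine_diam_ge0.
Qed.

Lemma hausdorff_measure_pinfty h A :
  (forall M : R, exists2 delta0 : R, 0 < delta0 &
     forall delta, 0 < delta -> delta < delta0 -> (M%:E <= hausdorff_content h delta A)%E) ->
  hausdorff_measure h A = +oo%E.
Proof.
move=> H; apply/cvg_lim => //; apply/cvgeyPge => M.
have [d0 d00 dP] := H M; near=> delta; apply: dP; near: delta; [exact: nbhs_right_gt | exact: nbhs_right_lt].
Unshelve. all: by end_near. Qed.

Lemma hausdorff_measure_eq0 h A : dimension_function h ->
  (forall delta e : R, 0 < delta -> 0 < e -> (hausdorff_content h delta A <= e%:E)%E) ->
  hausdorff_measure h A = 0%E.
Proof.
move=> hh H; apply/cvg_lim => //; apply: cvg_near_cst; near=> delta.
apply/eqP; rewrite eq_le hausdorff_content_ge0// andbT.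
by apply/lee_addgt0Pr => e e0; rewrite add0e; apply: H.
Unshelve. all: by end_near. Qed.

(** A Borel-Cantelli form of being null: each point is covered infinitely often, so every tail of
    the convergent sum is again a cover, and the lengths tending to 0 make the tails arbitrarily
    fine. *)
Definition thin (g : R -> R) N := exists a d : nat -> R, [/\ forall i, 0 < d i,
  forall delta : R, 0 < delta -> exists n, forall i, (n <= i)%N -> d i <= delta,
  exists B, forall n, \sum_(0 <= i < n) g (d i) <= B &
  forall x, N x -> forall n, exists2 i, (n <= i)%N & a i <= x <= a i + d i].

Lemma thin_tail (g : R -> R) N : (forall x, 0 <= g x) -> thin g N ->
  forall delta e : R, 0 < delta -> 0 < e -> exists a d : nat -> R,
  [/\ forall i, 0 < d i <= delta, forall n, \sum_(0 <= i < n) g (d i) <= e &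
  forall x, N x -> exists i, a i <= x <= a i + d i].
Proof.
move=> g0 [a [d [d0 dsmall [B sumB] cov]]] delta e delta0 e0.
have [n0 n0P] := dsmall delta delta0.
have [n1 n01 tail] := bounded_sum_tail n0 (fun i => g0 (d i)) sumB e0.
exists (fun i => a (i + n1)%N), (fun i => d (i + n1)%N); split => [i|n|x Nx].
- by rewrite d0 n0P// (leq_trans n01)// leq_addl.
- by have := tail (n + n1)%N; rewrite -{1}[n1]add0n big_addn addnK.
- have [i n1i xi] := cov x Nx n1; exists (i - n1)%N.
  by rewrite subnK.
Qed.

Lemma thin_measure0 h (g : R -> R) (r0 : R) N : dimension_function h ->
  (forall x, 0 <= g x) -> 0 < r0 -> (forall r, 0 < r < r0 -> h r = g r) ->
  thin g N -> hausdorff_measure h N = 0%E.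
Proof.
move=> hh g0 r00 hg thinN; apply: hausdorff_measure_eq0 => // delta e delta0 e0.
have m0 : 0 < Num.min delta (r0 / 2) by rewrite lt_min delta0 divr_gt0.
have [a [d [dP sumd cov]]] := thin_tail g0 thinN m0 e0.
apply: ge_ereal_inf; exists (\sum_(0 <= i <oo) (g (d i))%:E)%E; last exact: nneseries_le.
exists (fun i => [set x | a i <= x <= a i + d i]).
  split=> [x /cov[i xi]|i]; first by exists i.
  have /andP[di0] := dP i; rewrite le_min => /andP[did _].
  by rewrite diam_itv.
apply: eq_eseriesr => i _; have /andP[di0] := dP i; rewrite le_min => /andP[_ dir].
rewrite diam_itv//= hg// di0 (le_lt_trans dir)// ltr_pdivrMr//.
by rewrite mulr_natr mulr2n ltrDl.
Qed.

Lemma half_powers_sum (n : nat) : \sum_(0 <= i < n) (2 ^+ i.+1)^-1 <= 1 :> R.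
Proof.
suff -> : \sum_(0 <= i < n) (2 ^+ i.+1)^-1 = 1 - (2 ^+ n)^-1 :> R.
  by rewrite gerBl invr_ge0 exprn_ge0.
elim: n => [|n IH]; first by rewrite big_geq// expr0 invr1 subrr.
rewrite big_nat_recr//= IH exprS invfM.
by move: ((2 ^+ n)^-1 : R) => X; lra.
Qed.

Lemma interleave_sum (f u v : nat -> R) (A B : R) : (forall i, 0 <= f i) ->
  (forall i, f i.*2 = u i) -> (forall i, f i.*2.+1 = v i) ->
  (forall n, \sum_(0 <= i < n) u i <= A) -> (forall n, \sum_(0 <= i < n) v i <= B) ->
  forall n, \sum_(0 <= i < n) f i <= A + B.
Proof.
move=> f0 fu fv uA vB n.
have E m : \sum_(0 <= i < m.*2) f i = \sum_(0 <= i < m) u i + \sum_(0 <= i < m) v i.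
  elim: m => [|m IH]; first by rewrite !big_geq// addr0.
  by rewrite doubleS !big_nat_recr//= IH fu fv -addrA addrACA.
apply: (@le_trans _ _ (\sum_(0 <= i < n.*2) f i)); last by rewrite E lerD.
rewrite -addnn (@big_cat_nat _ _ _ n 0 (n + n))//= ?leq_addr// lerDl.
exact: sumr_ge0.
Qed.

End Hausdorff.

(** * From escaping points to infinite Hausdorff measure *)

Section LowerBound.
Context {R : realType} (tau kappa : R).
Context (htau : 2 < tau) (hkappa : kappa <= -1).

(** A fine cover of A of bounded weight, interleaved with a light cover of N, would be escaped by a
    point of the limsup set, which A and N together contain. Bounding h only from below lets one
    gauge serve all larger ones. *)
Lemma hausdorff_measure_well_approximable (h : R -> R) (r0 : R) (A N : set R) :
  dimension_function h -> 0 < r0 ->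
  (forall r, 0 < r < r0 -> gauge (2 / tau) kappa r <= h r) ->
  thin (gauge (2 / tau) kappa) N ->
  well_approximable tau kappa `<=` A `|` N ->
  hausdorff_measure h A = +oo%E.
Proof.
move=> hh r00 gh thinN WAN; have [h0 hmono hcont] := hh.
have g0 x : 0 <= gauge (2 / tau) kappa x by rewrite mulr_ge0// powR_ge0.
apply: hausdorff_measure_pinfty => M0.
pose M := Num.max M0 0; have M00 : 0 <= M by rewrite le_max lexx orbT.
(* One unit pays for enlarging the degenerate sets of the cover, the other for the cover of N. *)
have [d1 d10 escape] := well_approximable_escape htau hkappa (M + 1 + 1).
have [aN [dN [dNP sumN covN]]] := thin_tail g0 thinN d10 ltr01.
exists (Num.min d1 r0); first by rewrite lt_min d10.
move=> delta delta0; rewrite lt_min => /andP[deltad deltar].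
apply: le_ereal_inf_tmp => _ [U [AU Ud] <-].
rewrite leNgt; apply/negP => small.
pose D i := fine (diam (U i)).
have D0 i : 0 <= D i by exact: fine_diam_ge0.
have hD0 i : 0 <= h (D i) by rewrite -h0 hmono.
have sumM : forall n, \sum_(0 <= i < n) h (D i) <= M.
  apply: nneseries_ge_sum => //; apply: ltW; apply: lt_le_trans small _.
  by rewrite lee_fin le_max lexx.
(* The game takes intervals of positive length only; sets of diameter 0 are enlarged to such
   lengths, at total weight at most 1. *)
have tiny i : exists e, 0 < e <= d1 /\ gauge (2 / tau) kappa e <= (2 ^+ i.+1)^-1.
  have q0 : 0 < (2 ^+ i.+1)^-1 :> R by rewrite invr_gt0 exprn_gt0.
  have : \forall r \near 0^'+, `|h r| <= (2 ^+ i.+1)^-1.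
    by have /cvgr0Pnorm_le := hcont; apply.
  move=> H; near (0 : R)^'+ => e; exists e; split.
    by apply/andP; split; near: e; [exact: nbhs_right_gt | exact: nbhs_right_le].
  have e0 : 0 < e by near: e; exact: nbhs_right_gt.
  apply: (@le_trans _ _ (h e)).
    by apply: gh; rewrite e0/=; near: e; exact: nbhs_right_lt.
  apply: le_trans (ler_norm _) _; near: e; exact: H.
have [ee eeP] := choice tiny.
pose dU i := if 0 < D i then D i else ee i.
have dUP i : 0 < dU i <= d1.
  rewrite /dU; case: ifPn => [->/=|_]; last by have [] := eeP i.
  have := Ud i; rewrite /D; move: (diam (U i)) => [x||] //=.
    by rewrite lee_fin => /le_trans; apply; exact: ltW.
  by move=> _; exact: ltW.
have DdU i : D i <= dU i.
  by rewrite /dU; case: ltP => // /le_trans; apply; have [/andP[/ltW]] := eeP i.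
have gU i : gauge (2 / tau) kappa (dU i) <= h (D i) + (2 ^+ i.+1)^-1.
  rewrite /dU; case: ltP => Di.
    rewrite ler_wpDr ?invr_ge0 ?exprn_ge0//; apply: gh; rewrite Di/=.
    have := Ud i; move: Di; rewrite /D; move: (diam (U i)) => [x||] //=.
    by rewrite lee_fin => _ /le_lt_trans; apply.
  by rewrite ler_wpDl//; have [] := eeP i.
have sumU n : \sum_(0 <= i < n) gauge (2 / tau) kappa (dU i) <= M + 1.
  apply: (@le_trans _ _ (\sum_(0 <= i < n) (h (D i) + (2 ^+ i.+1)^-1))).
    exact: ler_sum.
  by rewrite big_split lerD// half_powers_sum.
have UD i x : U i x -> inf (U i) <= x <= inf (U i) + dU i.
  move=> Ux; have dist y z : U i y -> U i z -> `|y - z| <= dU i.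
    move=> Uy Uz; apply: le_trans (DdU i); rewrite /D.
    have yz : (`|y - z|%:E <= diam (U i))%E by apply: ereal_sup_ubound; exists (y, z).
    by move: yz (Ud i); case: (diam (U i)) => [w||] //=; rewrite lee_fin.
  have lb y : U i y -> x - dU i <= y.
    by move=> Uy; have := dist _ _ Ux Uy; rewrite ler_norml => /andP[]; lra.
  apply/andP; split; first by apply: ge_inf => //; exists (x - dU i).
  by rewrite -lerBlDr; apply: lb_le_inf; [exists x | move=> y; exact: lb].
pose a j := if odd j then aN j./2 else inf (U j./2).
pose d j := if odd j then dN j./2 else dU j./2.
have dP j : 0 < d j <= d1 by rewrite /d; case: ifP.
have sumd n : \sum_(0 <= j < n) gauge (2 / tau) kappa (d j) <= M + 1 + 1.
  apply: interleave_sum sumU sumN n => // i; rewrite /d.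
    by rewrite odd_double doubleK.
  by rewrite /= odd_double uphalf_double.
have [x Wx nx] := escape a d dP sumd.
have [/AU[i _ Ux]|/covN[i xi]] := WAN x Wx.
  by apply: (nx i.*2); rewrite /a /d odd_double doubleK; exact: UD.
by apply: (nx i.*2.+1); rewrite /a /d /= odd_double uphalf_double.
Unshelve. all: by end_near. Qed.

End LowerBound.

(** * Limsup sets of finite weight *)

Section PSeries.
Context {R : realType}.

(** Cauchy condensation: the terms from 2^m up to 2^(m+1) sum to at most u^m, where u = 2^(1-s) <
    1. *)
Lemma p_series_bounded (s : R) : 1 < s ->
  exists B, forall n, \sum_(1 <= k < n) k%:R `^ (- s) <= B.
Proof.
move=> s1; pose u : R := 2 `^ (1 - s).
have u0 : 0 < u by rewrite powR_gt0.
have u1 : u < 1.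
  rewrite /u powR_expR// expR_lt1 pmulr_llt0 ?subr_lt0//.
  by rewrite ln_gt0// ltr1n.
have v0 : 0 < 1 - u by rewrite subr_gt0.
have H m : \sum_(1 <= k < 2 ^ m) k%:R `^ (- s) <= (1 - u ^+ m) / (1 - u).
  elim: m => [|m IH]; first by rewrite expn0 big_geq// expr0 subrr mul0r.
  have p0 : (0 < 2 ^ m)%N by rewrite expn_gt0.
  have pp : (2 ^ m <= 2 ^ m.+1)%N by rewrite leq_exp2l.
  rewrite (@big_cat_nat _ _ _ (2 ^ m))//=.
  have -> : (1 - u ^+ m.+1) / (1 - u) = (1 - u ^+ m) / (1 - u) + u ^+ m.
    by rewrite exprS; field; rewrite gt_eqF.
  apply: lerD => //.
  apply: (@le_trans _ _ (\sum_(2 ^ m <= k < 2 ^ m.+1) ((2 ^ m)%:R `^ (- s)))).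
    apply: ler_sum_nat => k /andP[k1 k2]; apply: powR_le_neg; rewrite ?ltr0n ?ler_nat//.
    by rewrite oppr_le0 ltW// (lt_trans ltr01).
  rewrite sumr_const_nat expnS mul2n -addnn addnK -[leLHS]mulr_natl.
  have p0' : (0 : R) < (2 ^ m)%:R by rewrite ltr0n.
  rewrite -{1}[(2 ^ m)%:R]powRr1 ?(ltW p0')// -powRD; last by rewrite (gt_eqF p0') implybT.
  have -> // : (2 ^ m)%:R `^ (1 - s) = u ^+ m.
  by rewrite natrX -powR_mulrn// -powRrM mulrC powRrM powR_mulrn// ltW.
exists (1 - u)^-1 => n; have h : (n <= 2 ^ n)%N by apply/ltnW/ltn_expl.
apply: (@le_trans _ _ (\sum_(1 <= k < 2 ^ n) k%:R `^ (- s))).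
  have [n0|n0] := posnP n; first by rewrite n0 big_geq// sumr_ge0// => k _; exact: powR_ge0.
  by rewrite (@big_cat_nat _ _ _ n 1 (2 ^ n))//= lerDl sumr_ge0// => k _; exact: powR_ge0.
apply: le_trans (H n) _; rewrite ler_pdivrMr// mulVf ?gt_eqF//.
by rewrite gerBl exprn_ge0// ltW.
Qed.

End PSeries.

(** * Flattening a sequence of finite blocks of intervals *)

Section Blocks.
Context {R : realType} (g : R -> R) (B : nat -> seq R) (d : nat -> R) (N : set R).
Context (g0 : forall x, 0 <= g x) (B0 : forall k, (0 < size (B k))%N).
Context (d0 : forall k, 0 < d k).
Context (dsmall : forall e : R, 0 < e -> exists n, forall k, (n <= k)%N -> d k <= e).
Context (C : R) (sumC : forall n, \sum_(0 <= k < n) (size (B k))%:R * g (d k) <= C).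
Context (cov : forall x, N x -> forall K, exists2 k, (K <= k)%N &
  exists2 c, c \in B k & c <= x <= c + d k).

(** The tag k recovers the common length of the block. Blocks are nonempty, so [L i.+1] has an entry
    at position i and the default value in [e] is never reached. *)
Let blk k := [seq (c, k) | c <- B k].
Let L := fix L n := if n is m.+1 then L m ++ blk m else [::].
Let e i := nth (0, 0%N) (L i.+1) i.

Let size_L n : (n <= size (L n))%N.
Proof.
elim: n => //= n IH; rewrite size_cat size_map -addn1; apply: leq_add => //.
Qed.

Let prefix_L n m : (n <= m)%N -> exists s, L m = L n ++ s /\
  forall z, z \in s -> (n <= z.2)%N.
Proof.
elim: m => [|m IH]; first by rewrite leqn0 => /eqP ->; exists [::].
rewrite leq_eqVlt => /predU1P[->|]; first by exists [::]; rewrite cats0.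
rewrite ltnS => nm; have [s [sE sP]] := IH nm; exists (s ++ blk m); rewrite catA -sE.
split=> // z; rewrite mem_cat => /orP[/sP//|/mapP[c _ ->]] //.
Qed.

Let nth_L n i : (i < size (L n))%N -> nth (0, 0%N) (L n) i = e i.
Proof.
move=> iL; have [ni|ni] := leqP n i.+1.
  by have [s [sE _]] := prefix_L ni; rewrite /e sE nth_cat iL.
have [s [sE _]] := prefix_L (ltnW ni).
by rewrite sE nth_cat size_L.
Qed.

Let index_ge n i : (size (L n) <= i)%N -> (n <= (e i).2)%N.
Proof.
move=> Li; have ni : (n <= i.+1)%N by rewrite (leq_trans (size_L n))// (leq_trans Li).
have [s [sE sP]] := prefix_L ni; rewrite /e sE nth_cat ltnNge Li/=.
apply: sP; apply: mem_nth; rewrite ltn_subLR//.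
by have := size_L i.+1; rewrite sE size_cat.
Qed.

Lemma thin_blocks : thin g N.
Proof.
exists (fun i => (e i).1), (fun i => d (e i).2); split => // [delta delta0||x Nx n].
- have [n nP] := dsmall delta0; exists (size (L n)) => i /index_ge; exact: nP.
- exists C => n; apply: le_trans (sumC n).
  have -> : \sum_(0 <= k < n) (size (B k))%:R * g (d k) = \sum_(z <- L n) g (d z.2).
    elim: n => [|n IH]; first by rewrite big_geq// big_nil.
    rewrite big_nat_recr//= IH big_cat/=; congr (_ + _).
    by rewrite big_map/= big_const_seq count_predT iter_addr_0 mulr_natl.
  rewrite (big_nth (0, 0%N)) (@big_cat_nat _ _ _ n 0 (size (L n)))//=.
  rewrite -[leLHS]addr0 lerD ?sumr_ge0//.
  apply: ler_sum_nat => i /andP[_ iN]; rewrite nth_L//.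
  exact: leq_trans iN (size_L n).
- have [k nk [c cB cx]] := cov Nx n.
  have cL : (c, k) \in L k.+1 by rewrite /= mem_cat map_f ?orbT.
  have [s [sE _]] := prefix_L (leqnSn k).
  have [j jb jE] : exists2 j, (j < size (blk k))%N & nth (0, 0%N) (blk k) j = (c, k).
    by apply/nthP; rewrite map_f.
  have ij : (size (L k) + j < size (L k.+1))%N by rewrite /= size_cat ltn_add2l.
  exists (size (L k) + j)%N.
    by rewrite (leq_trans nk)// (leq_trans (size_L k))// leq_addr.
  rewrite -(nth_L ij) /= nth_cat ltnNge leq_addr/= addKn.
  by rewrite jE.
Qed.

End Blocks.

(** * Limsup sets over dyadic blocks of denominators *)

Section DyadicLimsup.
Context {R : realType} (tau : R) (htau : 2 < tau).

Definition dyadic_radius (a : R) (k : nat) : R := (2 ^+ k) `^ (- tau) * k%:R `^ a.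

Definition dyadic_limsup (a : R) : set R :=
  [set x | forall K, exists k (q : nat) (p : int), [/\ (K <= k)%N,
    (2 ^ k <= q < 2 ^ k.+1)%N & `|x - p%:~R / q%:R| < dyadic_radius a k]].

Let tau_gt0 : 0 < tau. Proof. by apply: lt_trans htau. Qed.

Lemma pow2_expR (k : nat) (z : R) : (2 ^+ k) `^ z = expR (z * ln 2 * k%:R).
Proof. by rewrite -powR_mulrn// -powRrM powR_expR//; congr expR; ring. Qed.

Lemma ln2_gt0 : 0 < ln 2 :> R. Proof. by rewrite ln_gt0// ltr1n. Qed.

(** The limsup set is unbounded, whereas each block may hold only finitely many intervals. Block k
    therefore covers a window of half-width about k^ep: every point is inside eventually, and the
    number of intervals grows only by the factor k^ep. *)
Lemma dyadic_limsup_thin (kappa a : R) : kappa <= 0 -> kappa + 2 * a / tau < -1 ->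
  thin (gauge (2 / tau) kappa) (dyadic_limsup a).
Proof.
move=> kappa0 ka.
(* Half of the available room: one ep pays for the growing window, the other leaves the summable
   power k^(-1-ep). *)
pose ep := (- 1 - (kappa + 2 * a / tau)) / 2.
have ep0 : 0 < ep by rewrite /ep; lra.
have t1 : 0 < (tau - 1) * ln 2 by have h := htau; apply: mulr_gt0; [lra | exact: ln2_gt0].
have [K0 K0P] := @poly_le_exp R 2 a _ ltac:(lra) t1.
(* From k0 on the interval length is at most 2^(-k), so its logarithm is at least k ln 2; as kappa
   <= 0, this bounds the logarithmic factor of the gauge from above. *)
pose k0 := maxn 1 K0.
have k0P k : (k0 <= k)%N -> (0 < k)%N /\ 2 * dyadic_radius a k <= (2 ^+ k)^-1.
  rewrite geq_max => /andP[k1 /K0P h]; split => //.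
  have p0 : 0 < 2 ^+ k :> R by rewrite exprn_gt0.
  move: h; have -> : expR ((tau - 1) * ln 2 * k%:R) = (2 ^+ k) `^ tau / 2 ^+ k.
    by rewrite -pow2_expR powRB ?(gt_eqF p0) ?implybT// powRr1// ltW.
  rewrite /dyadic_radius powRN ler_pdivlMr// => h.
  have q0 : 0 < (2 ^+ k) `^ tau :> R by rewrite powR_gt0.
  rewrite -[leRHS]mul1r ler_pdivlMr//.
  have -> : 2 * (((2 ^+ k) `^ tau)^-1 * k%:R `^ a) * 2 ^+ k =
     2 * k%:R `^ a * 2 ^+ k / (2 ^+ k) `^ tau by ring.
  by rewrite ler_pdivrMr// mul1r.
pose P k := Num.truncn (k%:R `^ ep * 2 ^+ k.+1 : R).
pose blk k := [seq (j%:R - (P k)%:R) / q%:R - dyadic_radius a k |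
   q <- iota (2 ^ k) (2 ^ k), j <- iota 0 (P k).*2.+1].
pose C : R := 2 `^ (2 / tau) * (ln 2) `^ kappa.
have C0 : 0 <= C by rewrite mulr_ge0// powR_ge0.
have rad0 k : (0 < k)%N -> 0 < dyadic_radius a k.
  by move=> ?; rewrite mulr_gt0// powR_gt0 ?exprn_gt0// ltr0n.
have [B BP] := @p_series_bounded R (1 + ep) ltac:(by rewrite ltrDl).
apply: (@thin_blocks R _ (fun k => blk (k + k0)%N)
  (fun k => 2 * dyadic_radius a (k + k0)%N) _ _ _ _ _ (5 * C * B)).
- by move=> x; rewrite mulr_ge0// powR_ge0.
- by move=> k; rewrite size_allpairs !size_iota muln_gt0 expn_gt0.
- by move=> k; have [? _] := k0P _ (leq_addl k k0); rewrite mulr_gt0// rad0.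
- move=> e e0; exists (Num.truncn e^-1).+1 => k ek.
  have [kk h] := k0P _ (leq_addl k k0); apply: le_trans h _.
  rewrite invf_ple ?posrE ?exprn_gt0//; apply: ltW.
  apply: lt_le_trans (truncnS_gt _) _; rewrite -natrX ler_nat.
  by rewrite (leq_trans ek)// (leq_trans (leq_addr k0 _))// ltnW// ltn_expl.
- move=> n.
  have term k : (k0 <= k)%N -> (size (blk k))%:R * gauge (2 / tau) kappa (2 * dyadic_radius a k) <=
      5 * C * k%:R `^ (- (1 + ep)).
    move=> /k0P[kk h]; have k0' : 0 < k%:R :> R by rewrite ltr0n.
    have p0 : 0 < 2 ^+ k :> R by rewrite exprn_gt0.
    have r0 := rad0 _ kk.
    have gle : gauge (2 / tau) kappa (2 * dyadic_radius a k) <=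
        C * ((2 ^+ k) ^+ 2)^-1 * k%:R `^ (2 * a / tau + kappa).
      rewrite /gauge /dyadic_radius !powRM ?powR_ge0// ?mulr_ge0 ?powR_ge0// -!powRrM.
      have -> : - tau * (2 / tau) = - 2%:R by field; rewrite gt_eqF.
      rewrite powR_invn ?(ltW p0)//.
      have -> : a * (2 / tau) = 2 * a / tau by ring.
      rewrite powRD ?(gt_eqF k0') ?implybT// /C.
      set L := (ln (1 / _)) `^ _; have : L <= (ln 2) `^ kappa * k%:R `^ kappa.
        rewrite -powRM ?(ltW ln2_gt0) ?(ltW k0')//; apply: powR_le_neg => //.
          by rewrite mulr_gt0 ?ln2_gt0.
        rewrite mul1r lnV ?posrE ?mulr_gt0 ?powR_gt0//.
        have : ln (2 * dyadic_radius a k) <= ln (2 ^+ k)^-1.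
          have r2 : 0 < 2 * dyadic_radius a k by rewrite mulr_gt0.
          have i0 : 0 < (2 ^+ k)^-1 :> R by rewrite invr_gt0.
          by rewrite ler_ln.
        by rewrite lnV ?posrE// lnXn// -/(dyadic_radius a k) lerNr mulr_natr.
      move=> hL; apply: le_trans (ler_wpM2l _ hL) _.
        by rewrite !mulr_ge0 ?powR_ge0// invr_ge0 exprn_ge0// ltW.
      rewrite le_eqVlt; apply/orP; left; apply/eqP; ring.
    have sz : (size (blk k))%:R <= 5 * (2 ^+ k) ^+ 2 * k%:R `^ ep :> R.
      rewrite size_allpairs !size_iota natrM natrX.
      have ke : 1 <= k%:R `^ ep :> R.
        by rewrite -[leLHS](powRr0 k%:R) ler_powR ?ler1n// ltW.
      have p1 : 1 <= 2 ^+ k :> R by rewrite exprn_ege1// ler1n.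
      have PP : (P k)%:R <= k%:R `^ ep * 2 ^+ k.+1 :> R.
        by rewrite truncn_le mulr_ge0 ?powR_ge0// exprn_ge0.
      have : (P k).*2.+1%:R <= 5 * 2 ^+ k * k%:R `^ ep :> R.
        rewrite -natr1 -mul2n natrM; move: PP; rewrite exprS => PP.
        have : 1 <= 2 ^+ k * k%:R `^ ep :> R by rewrite mulr_ege1.
        move: PP; have -> : k%:R `^ ep * (2 * 2 ^+ k) = 2 * (2 ^+ k * k%:R `^ ep) by ring.
        rewrite -[5 * _ * _]mulrA; move: (2 ^+ k * _) (P k)%:R => X Y; lra.
      move=> /(ler_wpM2l (ltW p0)) /le_trans; apply.
      by rewrite le_eqVlt; apply/orP; left; apply/eqP; ring.
    apply: le_trans (ler_pM _ _ sz gle) _ => //.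
      by rewrite mulr_ge0// powR_ge0.
    have -> : - (1 + ep) = ep + (2 * a / tau + kappa) by rewrite /ep; field; rewrite gt_eqF.
    rewrite [_ `^ (ep + _)]powRD ?(gt_eqF k0') ?implybT//.
    rewrite le_eqVlt; apply/orP; left; apply/eqP; field.
    by rewrite expf_neq0.
  apply: (@le_trans _ _ (\sum_(0 <= k < n) 5 * C * (k + k0)%N%:R `^ (- (1 + ep)))).
    by apply: ler_sum => k _; apply: term; exact: leq_addl.
  rewrite -mulr_sumr ler_wpM2l//; first by rewrite mulr_ge0.
  apply: le_trans (BP (n + k0)%N).
  have k01 : (1 <= k0)%N by rewrite leq_max.
  rewrite (@big_cat_nat _ _ _ k0 1 (n + k0))//= ?leq_addl//.
  rewrite -{3}[k0]add0n big_addn addnK lerDr sumr_ge0// => i _; exact: powR_ge0.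
- move=> x Nx K.
  have [K1 K1P] : exists K1 : nat, forall k, (K1 <= k)%N -> `|x| + 1 <= k%:R `^ ep.
    exists (Num.truncn ((`|x| + 1) `^ ep^-1)).+1 => k kx.
    have x1 : 0 <= `|x| + 1 by rewrite addr_ge0.
    have -> : `|x| + 1 = ((`|x| + 1) `^ ep^-1) `^ ep.
      by rewrite -powRrM mulVf ?gt_eqF// powRr1.
    apply: ge0_ler_powR; rewrite ?nnegrE ?powR_ge0 ?(ltW ep0)//; apply: ltW.
    by apply: lt_le_trans (truncnS_gt _) _; rewrite ler_nat.
  have [k [q [p [Kk qk xpq]]]] := Nx (maxn (K + k0) K1).
  move: Kk; rewrite geq_max => /andP[Kk K1k].
  have k0k : (k0 <= k)%N by rewrite (leq_trans _ Kk)// leq_addl.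
  have [kk h] := k0P k k0k.
  exists (k - k0)%N; first by rewrite leq_subRL// addnC.
  rewrite subnK//; have /andP[q1 q2] := qk.
  have q0 : 0 < q%:R :> R by rewrite ltr0n (leq_trans _ q1)// expn_gt0.
  exists (p%:~R / q%:R - dyadic_radius a k); last first.
    move: xpq; rewrite ltr_distl => /andP[h1 h2].
    by apply/andP; split; lra.
  have pP : (`|p| <= P k)%N.
    rewrite /P truncn_ge_nat; last by rewrite mulr_ge0 ?powR_ge0// exprn_ge0.
    have -> : `|p|%N%:R = `|p%:~R| :> R by rewrite natr_absz intr_norm.
    have r1 : dyadic_radius a k <= 1.
      have := rad0 _ kk; have : (2 ^+ k)^-1 <= 1 :> R by rewrite invf_le1 ?exprn_gt0// exprn_ege1// ler1n.
      by move: h; lra.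
    have : `|p%:~R / q%:R| <= `|x| + 1.
      have := ler_normB x (x - p%:~R / q%:R); rewrite opprB addrC subrK => h1.
      apply: le_trans h1 _; rewrite lerD2l; exact/ltW/(lt_le_trans xpq).
    rewrite normrM normfV (gtr0_norm q0) ler_pdivrMr// => /le_trans; apply.
    apply: ler_pM; [exact: addr_ge0 | exact: ltW | exact: K1P | ].
    by rewrite -natrX ler_nat ltnW.
  (* The shift by [P k] turns the integers of absolute value at most [P k] into the indices of the
     natural range. *)
  apply/allpairsP; exists (q, absz (p + Posz (P k))); split.
  - by rewrite mem_iota/=; move: qk; rewrite expnS mul2n addnn.
  - by rewrite mem_iota/=; move: pP; clear; lia.
  - congr (_ / _ - _); rewrite natr_absz ger0_norm; last by move: pP; clear; lia.
    by rewrite intrD addrK.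
Qed.

End DyadicLimsup.

(** * Irrationality exponent and the sine series *)

Section IrrationalityExponent.
Context {R : realType}.
Implicit Types (x sigma tau a : R).

Lemma rat_bounded_finite x (c : R) (K : nat) :
  finite_set [set r : rat | `|x - ratr r| <= c /\ denq r < K%:Z].
Proof.
pose P := Num.truncn ((`|x| + `|c|) * K%:R).
pose f (z : nat * nat) : rat := (z.2%:Z - P%:Z)%:~R / z.1%:R.
pose S := [seq (q, j) | q <- iota 0 K, j <- iota 0 P.*2.+1].
have SP q j : (q < K)%N -> (j < P.*2.+1)%N -> (q, j) \in S.
  by move=> qK jP; apply/allpairsP; exists (q, j); split; rewrite ?mem_iota.
clearbody S; apply: (@sub_finite_set _ _ [set` map f S]); last exact: finite_seq.
move=> r [xr dK]; have d0 := denq_gt0 r.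
have nP : (`|numq r| <= P)%N.
  rewrite truncn_ge_nat; last by rewrite mulr_ge0// addr_ge0.
  have -> : (`|numq r|%N)%:R = `|ratr r * (denq r)%:~R| :> R.
    by rewrite natr_absz intr_norm /ratr divfK// intr_eq0 gt_eqF.
  rewrite normrM; apply: ler_pM => //.
    have := ler_normB x (x - ratr r); rewrite opprB addrC subrK => h.
    apply: le_trans h _; rewrite lerD2l; exact: le_trans xr (ler_norm _).
  by rewrite gtr0_norm ?ltr0z// pmulrn ler_int ltW.
apply/mapP; exists (absz (denq r), absz (numq r + P%:Z)).
  by apply: SP; [move: dK d0 | move: nP]; clear; lia.
rewrite /f/= abszE ger0_norm; last by move: nP; clear; lia.
rewrite addrK natr_absz gtr0_norm//.
by rewrite divq_num_den.
Qed.

(** For sigma strictly between tau and the exponent, infinitely many fractions have error below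
    q^(-sigma); the spare power q^(-(sigma - tau)) beats any power of log q, so a may have either
    sign. *)
Lemma lt_irr_exponent x tau a : 0 < tau -> (tau%:E < irr_exponent x)%E ->
  dyadic_limsup tau a x.
Proof.
move=> tau0 h.
have [sigma ts sx] : exists2 sigma, tau < sigma & (sigma%:E < irr_exponent x)%E.
  move: h; case: (irr_exponent x) => [r||] //.
    rewrite lte_fin => tr; exists ((tau + r) / 2); rewrite ?lte_fin; lra.
  by move=> _; exists (tau + 1); rewrite ?ltry// ltrDl.
have s0 : 0 < sigma by exact: lt_trans ts.
set F := [set r : rat | `|x - ratr r| < ((denq r)%:~R : R) `^ (- sigma)].
have Finf : ~ finite_set F.
  move=> Ff; have : (irr_exponent x <= sigma%:E)%E.
    by apply: ereal_inf_lbound; exists sigma.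
  by rewrite leNgt sx.
have e0 : 0 < (sigma - tau) * ln 2 :> R by rewrite mulr_gt0 ?subr_gt0// ln2_gt0.
have [K1 K1P] := @poly_le_exp R 1 (- a) _ ltr01 e0.
move=> K; pose K2 := maxn (maxn K K1) 1.
have [r [Fr Kr]] : exists r, F r /\ ((2 ^ K2)%N%:Z <= denq r).
  apply: contrapT => H; apply: Finf.
  apply: sub_finite_set (rat_bounded_finite x 1 (2 ^ K2)) => r Fr; split.
    apply: le_trans (ltW Fr) _; rewrite -[leRHS](powRr0 (denq r)%:~R) ler_powR//.
      by rewrite (_ : 1 = 1%:~R)// ler_int -gtz0_ge1 denq_gt0.
    by rewrite oppr_le0 ltW.
  by rewrite ltNge; apply/negP => ?; apply: H; exists r.
pose q := absz (denq r); have qE : denq r = q%:Z by rewrite /q abszE gtr0_norm.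
have q0 : (0 < q)%N by rewrite absz_gt0 denq_neq0.
have /andP[k1 k2] := @trunc_log_bounds 2 q isT q0.
set k := trunc_log 2 q in k1 k2.
have K2k : (K2 <= k)%N.
  rewrite -ltnS -(@ltn_exp2l 2)//; apply: leq_ltn_trans k2.
  by move: Kr; rewrite qE lez_nat.
move: K2k; rewrite !geq_max => /andP[/andP[Kk K1k] k0].
exists k, q, (numq r); split => //; first by rewrite k1.
have -> : (numq r)%:~R / q%:R = ratr r :> R by rewrite /ratr qE.
apply: lt_le_trans Fr _; rewrite qE -pmulrn.
have p0 : 0 < 2 ^+ k :> R by rewrite exprn_gt0.
have kR0 : 0 < k%:R :> R by rewrite ltr0n.
apply: (@le_trans _ _ ((2 ^+ k) `^ (- sigma))).
  by apply: powR_le_neg => //; rewrite ?oppr_le0 ?(ltW s0)// -natrX ler_nat.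
have := K1P k K1k; rewrite mul1r -pow2_expR powRN => h'.
have A0 : 0 < k%:R `^ a by exact: powR_gt0.
have -> : - sigma = - tau - (sigma - tau) by ring.
rewrite /dyadic_radius powRB ?(gt_eqF p0) ?implybT// ler_wpM2l ?powR_ge0//.
by rewrite invf_ple ?posrE// powR_gt0.
Qed.

(** Distinct fractions with denominators b and q differ by at least 1/(bq), so an error below q^(-2)
    forces q < b. The value 2 suffices to separate the rationals from a fibre with tau > 2. *)
Lemma rational_irr_exponent x : rational x -> (irr_exponent x <= 2%:E)%E.
Proof.
move=> [r0 _ <-]; apply: ereal_inf_lbound; exists 2 => //; split => //.
pose b := absz (denq r0).
apply: (@sub_finite_set _ _ ([set r0] `|`
  [set r : rat | `|ratr r0 - ratr r| <= 1 :> R /\ denq r < b%:Z])); last first.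
  by rewrite finite_setU; split; [exact: finite_set1 | exact: rat_bounded_finite].
move=> r /= Fr; have [->|ne] := eqVneq r r0; [by left | right].
have bE : denq r0 = b%:Z by rewrite /b abszE gtr0_norm.
have qE : denq r = `|denq r|%N%:Z by rewrite abszE gtr0_norm.
have b0 : 0 < b%:R :> R by rewrite ltr0n absz_gt0 denq_neq0.
move: Fr; rewrite /ratr qE bE; set q := absz (denq r).
have q0 : 0 < q%:R :> R by rewrite ltr0n absz_gt0 denq_neq0.
rewrite -!pmulrn.
have -> : (numq r0)%:~R / b%:R - (numq r)%:~R / q%:R =
    (numq r0 * q%:Z - numq r * b%:Z)%:~R / (b%:R * q%:R) :> R.
  by rewrite intrB !intrM -!pmulrn; field; rewrite !gt_eqF.
have n1 : 1 <= `|(numq r0 * q%:Z - numq r * b%:Z)%:~R| :> R.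
  rewrite -intr_norm (_ : 1 = 1%:~R)// ler_int -gtz0_ge1 normr_gt0 subr_eq0.
  apply: contra ne => /eqP e; apply/eqP.
  rewrite -(divq_num_den r) -(divq_num_den r0) bE qE -/q.
  apply/eqP; rewrite eqr_div ?intr_eq0; last 2 first.
  - by rewrite -lt0n absz_gt0 denq_neq0.
  - by rewrite -lt0n absz_gt0 denq_neq0.
  by rewrite -!intrM -e.
rewrite normrM normfV [`|b%:R * _|]gtr0_norm ?mulr_gt0// powR_invn ?ler0n//.
rewrite ltr_pdivrMr ?mulr_gt0// => h.
have h2 := le_lt_trans n1 h.
have qb : q%:R < b%:R :> R.
  have e : (q%:R ^+ 2)^-1 * (b%:R * q%:R) = b%:R / q%:R :> R by field; rewrite gt_eqF.
  by move: h2; rewrite e ltr_pdivlMr// mul1r.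
split; last by move: qb; rewrite ltr_nat ltz_nat.
rewrite ler_pdivrMr ?mulr_gt0// mul1r; apply: le_trans (ltW h) _.
rewrite -[leRHS]mul1r ler_wpM2r ?mulr_ge0// invf_le1 ?exprn_gt0//.
by rewrite exprn_ege1// ler1n absz_gt0 denq_neq0.
Qed.

Lemma irr_exponent_irrational x tau : 2 < tau -> irr_exponent x = tau%:E -> irrational x.
Proof.
move=> t2 e /rational_irr_exponent; rewrite e lee_fin; lra.
Qed.

(* Unreduced fractions are allowed, so that every rational is its own
   approximation at every level. *)
Lemma rational_dyadic_limsup x tau a : rational x -> dyadic_limsup tau a x.
Proof.
move=> [r _ <-] K; pose d := absz (denq r).
have dE : denq r = d%:Z by rewrite /d abszE gtr0_norm.
have d0 : (0 < d)%N by rewrite absz_gt0 denq_neq0.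
pose k := maxn K.+1 d.
have dk : (d < 2 ^ k)%N by rewrite (leq_ltn_trans (leq_maxr K.+1 d))// ltn_expl.
pose c := (2 ^ k %/ d).+1; exists k, (c * d)%N, (numq r * c%:Z).
have dc : (2 ^ k < c * d)%N by rewrite -ltn_divLR.
split.
- by rewrite (leq_trans (leqnSn K))// leq_maxl.
- rewrite (ltnW dc)/= expnS mul2n -addnn /c mulSn addnC.
  by rewrite -addnS leq_add// leq_trunc_div.
have -> : (numq r * c%:Z)%:~R / (c * d)%:R = ratr r :> R.
  rewrite /ratr dE intrM -!pmulrn natrM; field.
  by rewrite !pnatr_eq0 -lt0n d0.
rewrite subrr normr0 mulr_gt0// powR_gt0 ?exprn_gt0//.
by rewrite ltr0n leq_max.
Qed.

Lemma radius_lt tau kappa sigma : sigma < tau ->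
  exists k1 : nat, forall k, (k1 <= k)%N ->
    radius tau kappa k < (17 * (scale k)%:R) `^ (- sigma).
Proof.
move=> st; pose b := - (kappa + 1) * tau / 2.
have ln100 : 0 < ln 100%:R :> R by rewrite ln_gt0// ltr1n.
have t2 : 0 < tau - sigma by rewrite subr_gt0.
have [K KP] := @poly_le_exp R 2 b ((tau - sigma) * ln 100%:R) ltac:(lra) (mulr_gt0 t2 ln100).
exists (maxn 1 K) => k; rewrite geq_max => /andP[k0 Kk].
have V0 := @scaleR_gt0 R k; have k0' : 0 < k%:R :> R by rewrite ltr0n.
move: (KP k Kk).
have -> : expR ((tau - sigma) * ln 100 * k%:R) = (scale k)%:R `^ (tau - sigma) :> R.
  rewrite powR_expR ?ltr0n ?scale_gt0// /scale natrX -powR_mulrn// ln_powR.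
  by congr expR; ring.
move=> h.
have {h} : 2 * k%:R `^ b <= (17 * (scale k)%:R) `^ (tau - sigma).
  apply: le_trans h _; apply: ge0_ler_powR; rewrite ?nnegrE ?(ltW t2) ?(ltW V0)//.
  by rewrite ler_peMl// ler1n.
set V := 17 * _ in V0 * => h.
have kb : 0 < k%:R `^ b by exact: powR_gt0.
have -> : - sigma = - tau + (tau - sigma) by ring.
rewrite [ltRHS]powRD ?(gt_eqF V0) ?implybT// /radius -/b -/V.
by rewrite ltr_pM2l ?powR_gt0//; move: kb h; lra.
Qed.

Lemma denq_le (p q : nat) : (0 < q)%N -> (`|denq (p%:R / q%:R)| <= q)%N.
Proof.
move=> q0; set r : rat := p%:R / q%:R.
have e : (numq r * q%:Z = p%:Z * denq r)%R.
  apply/eqP; rewrite -(@eqr_int rat) !intrM numqE mulrAC -!pmulrn.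
  by rewrite /r divfK// pnatr_eq0 -lt0n.
apply: dvdn_leq => //.
rewrite -(@Gauss_dvdr _ (absz (numq r))); last by rewrite coprime_sym coprime_num_den.
have : (`|numq r| * q = p * `|denq r|)%N by rewrite -(absz_nat q) -abszM e abszM.
by move=> ->; rewrite dvdn_mull.
Qed.

(** If only finitely many fractions were sigma-close for some sigma < tau, they would keep a
    positive distance from the irrational x, yet the approximations given by [well_approximable] are
    sigma-close and arbitrarily near. They may be unreduced; reducing only shrinks the denominator
    and so relaxes the sigma-condition. *)
Lemma well_approximable_irr_exponent x tau kappa : 2 < tau ->
  irrational x -> well_approximable tau kappa x -> (tau%:E <= irr_exponent x)%E.
Proof.
move=> t2 irx Wx; apply: le_ereal_inf_tmp => _ [sigma [s0 Ffin] <-].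
rewrite lee_fin leNgt; apply/negP => st.
have /finite_seqP[F FE] := Ffin.
have [e e0 eP] : exists2 e : R, 0 < e & forall r : rat, r \in F -> e <= `|x - ratr r|.
  elim: (F) => [|r F' [e e0 eP]]; first by exists 1.
  exists (Num.min e `|x - ratr r|).
    rewrite lt_min e0 normr_gt0 subr_eq0; apply/negP => /eqP xr.
    by apply: irx; exists r.
  move=> r'; rewrite inE => /predU1P[->|/eP h]; first by rewrite ge_min lexx orbT.
  by rewrite ge_min h.
have [k1 k1P] := radius_le kappa t2; have [k2 k2P] := radius_lt kappa st.
have [k [y [Kk [p [q [/andP[q1 q2] yE]]] xy]]] := Wx (maxn (maxn k1 k2) (Num.truncn e^-1).+1).
move: Kk; rewrite !geq_max => /andP[/andP[/k1P[k0 rk] /k2P rs] ke].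
have q0 : (0 < q)%N by rewrite (leq_trans _ q1)// muln_gt0 scale_gt0.
pose r : rat := p%:R / q%:R.
have rE : ratr r = y :> R by rewrite /r fmorph_div/= !ratr_nat yE.
have rF : r \in F.
  have : [set` F] r; last by [].
  rewrite -FE /= rE; apply: le_lt_trans xy _; apply: lt_le_trans rs _.
  have dd : denq r = `|denq r|%N%:Z by rewrite abszE gtr0_norm.
  apply: powR_le_neg; first by rewrite oppr_le0 ltW.
    by rewrite ltr0z.
  rewrite dd -pmulrn -natrM ler_nat.
  exact: leq_trans (denq_le p q0) (ltnW q2).
have := eP r rF; rewrite rE; apply/negP; rewrite -ltNge.
apply: le_lt_trans xy _; apply: le_lt_trans rk _.
have k0' : 0 < k%:R :> R by rewrite ltr0n.
have := @rho_le_inv R _ k0; have := @rho_gt0 R _ k0.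
have : k%:R^-1 <= e.
  rewrite invf_ple ?posrE//; apply/ltW/(lt_le_trans (truncnS_gt _)).
  by rewrite ler_nat.
lra.
Qed.

End IrrationalityExponent.

(** * The sine and the distance to the nearest integer; divergence of the series *)

Section Sine.
Context {R : realType}.
Implicit Types (x y u : R).

Lemma sin_addz u (m : int) : `|sin (u + pi * m%:~R)| = `|sin u|.
Proof.
have H (v : R) (n : nat) : `|sin (v + pi * n%:R)| = `|sin v|.
  rewrite mulr_natr (alternatingn (@sinDpi R)).
  by rewrite normrM normrX normrN1 expr1n mul1r.
case: m => n; first by rewrite -pmulrn H.
by rewrite NegzE mulrNz mulrN -(H (u - _) n.+1) -pmulrn subrK.
Qed.

Lemma sin_le_self u : 0 <= u -> `|sin u| <= u.
Proof.
move=> u0; have [|c _] := @MVT_segment R sin cos 0 u u0 (fun x _ => is_derive_sin x).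
  exact/continuous_subspaceT/continuous_sin.
rewrite sin0 !subr0 => ->; rewrite normrM (ger0_norm u0) ler_piMl//.
exact: cos_max.
Qed.

(** By the mean value theorem sin u = u cos c, and cos c = 1 - 2 sin(c/2)^2 is at least 1/2 because
    |sin(c/2)| <= c/2 <= 1/2. *)
Lemma sin_ge_half u : 0 <= u -> u <= 1 -> u / 2 <= sin u.
Proof.
move=> u0 u1; have [|c] := @MVT_segment R sin cos 0 u u0 (fun x _ => is_derive_sin x).
  exact/continuous_subspaceT/continuous_sin.
rewrite in_itv/= sin0 !subr0 => /andP[c0 cu] ->; rewrite mulrC ler_wpM2r//.
have h0 : 0 <= c / 2 by rewrite divr_ge0.
have -> : c = (c / 2) *+ 2 by rewrite -mulr_natr divfK.
have s := sin_le_self h0.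
rewrite cos_mulr2n -[cos _ ^+ 2](subKr 1) -sin2cos2.
have : sin (c / 2) ^+ 2 <= (1 / 2) ^+ 2.
  rewrite -real_normK ?num_real// ler_pXn2r ?nnegrE//.
  by apply: le_trans s _; rewrite ler_pM2r// (le_trans cu).
by move: (sin _ ^+ 2) => S; lra.
Qed.

(** Beyond 1, monotonicity gives sin u >= sin 1 >= 1/2 >= u/4, the last because pi/2 < 2. *)
Lemma sin_ge_quarter u : 0 <= u -> u <= pi / 2 -> u / 4 <= sin u.
Proof.
move=> u0 up; have [u1|u1] := leP u 1.
  by apply: le_trans (sin_ge_half u0 u1); lra.
have p2 := @pihalf_lt2 R; have p1 := @pihalf_ge1 R.
have : sin 1 <= sin u.
  have [<-//|ne] := eqVneq 1 u; apply/ltW; rewrite ltr_sin// in_itv/=; apply/andP; split; lra.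
by apply: le_trans; apply: le_trans (sin_ge_half ler01 (lexx _)); lra.
Qed.

Definition nint y : int := Num.floor (y + 1 / 2).
Definition ndist y : R := `|y - (nint y)%:~R|.

Lemma nint_itv y : - (1 / 2) <= y - (nint y)%:~R < 1 / 2.
Proof.
have := floor_itv (y + 1 / 2); rewrite -/(nint y) intrD => /andP[h1 h2].
by apply/andP; split; lra.
Qed.

Lemma ndist_le_half y : ndist y <= 1 / 2.
Proof. by have /andP[h1 h2] := nint_itv y; rewrite /ndist ler_norml; apply/andP; split; lra. Qed.

Lemma ndist_le y (m : int) : ndist y <= `|y - m%:~R|.
Proof.
have [->|ne] := eqVneq m (nint y); first by [].
apply: le_trans (ndist_le_half y) _.
have : 1 <= `|(m - nint y)%:~R| :> R.
  by rewrite -intr_norm (_ : 1 = 1%:~R)// ler_int -gtz0_ge1 normr_gt0 subr_eq0.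
have -> : (m - nint y)%:~R = (y - (nint y)%:~R) - (y - m%:~R) :> R by rewrite intrB; ring.
have := ler_normB (y - (nint y)%:~R) (y - m%:~R); have := ndist_le_half y; rewrite /ndist; lra.
Qed.

Lemma sin_ge_ndist y : ndist y / 2 <= `|sin (pi * y)|.
Proof.
have p2 := @pihalf_ge1 R.
have -> : pi * y = pi * (y - (nint y)%:~R) + pi * (nint y)%:~R by rewrite -mulrDr subrK.
rewrite sin_addz; have := ndist_le_half y; rewrite /ndist.
set v := y - _ => v2.
have -> : `|sin (pi * v)| = `|sin (pi * `|v|)|.
  by case: (ger0P v) => // _; rewrite mulrN sinN normrN.
have w0 : 0 <= `|v| by []. 
move: `|v| v2 w0 => w w2 w0.
have pw0 : 0 <= pi * w by rewrite mulr_ge0// pi_ge0.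
have pw2 : pi * w <= pi / 2 by rewrite ler_wpM2l ?pi_ge0// -div1r.
apply: le_trans (ler_norm _); apply: le_trans (sin_ge_quarter pw0 pw2).
have : w <= pi / 2 * w by rewrite ler_peMl.
lra.
Qed.

Lemma sin_le_dist y (m : int) : `|sin (pi * y)| <= pi * `|y - m%:~R|.
Proof.
have -> : pi * y = pi * (y - m%:~R) + pi * m%:~R by rewrite -mulrDr subrK.
rewrite sin_addz; set v := y - _.
have -> : `|sin (pi * v)| = `|sin (pi * `|v|)|.
  by case: (ger0P v) => // _; rewrite mulrN sinN normrN.
by apply: sin_le_self; rewrite mulr_ge0// pi_ge0.
Qed.

Lemma ndist_gt0 x (n : nat) : irrational x -> (0 < n)%N -> 0 < ndist (n%:R * x).
Proof.
move=> irx n0; rewrite /ndist normr_gt0 subr_eq0; apply/negP => /eqP e; apply: irx.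
apply/rationalP; exists (nint (n%:R * x)), n.
by rewrite -e mulrAC divff ?mul1r// pnatr_eq0 -lt0n.
Qed.

(** With s = t(tau - 1) the powers of q cancel exactly, so every such approximation produces a term
    of at least pi^(-t): the terms do not tend to 0. *)
Lemma sine_series_pinfty (s t tau x : R) : 1 < t -> 2 < tau -> s = t * (tau - 1) ->
  irrational x ->
  (forall K, exists (q : nat) (p : int), (K < q)%N /\ `|x - p%:~R / q%:R| <= q%:R `^ (- tau)) ->
  sine_series s t x = +oo%E.
Proof.
move=> t1 tau2 -> irx approx; apply/eqP; rewrite -leye_eq leNgt; apply/negP => fin.
pose f n := (((n%:R : R) `^ (- (t * (tau - 1))) * `|sin (pi * n%:R * x)| `^ (- t))%:E)%E.
have f0 n : (0 <= f n)%E by rewrite lee_fin mulr_ge0// powR_ge0.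
have t0 : 0 < t by lra.
have c0 : 0 < pi `^ (- t) :> R by rewrite powR_gt0 ?pi_gt0.
have big (q : nat) (p : int) : (0 < q)%N -> `|x - p%:~R / q%:R| <= q%:R `^ (- tau) ->
    ((pi `^ (- t))%:E <= f q)%E.
  move=> q0 xpq; rewrite lee_fin; have q0' : 0 < q%:R :> R by rewrite ltr0n.
  have s0 : 0 < `|sin (pi * q%:R * x)|.
    rewrite -mulrA; apply: lt_le_trans (sin_ge_ndist _).
    by rewrite divr_gt0// ndist_gt0.
  have s1 : `|sin (pi * q%:R * x)| <= pi * q%:R `^ (- (tau - 1)).
    rewrite -mulrA; apply: le_trans (sin_le_dist _ p) _.
    rewrite ler_wpM2l ?pi_ge0//.
    have -> : q%:R * x - p%:~R = q%:R * (x - p%:~R / q%:R) by field; rewrite gt_eqF.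
    rewrite normrM gtr0_norm// opprB powRD ?(gt_eqF q0') ?implybT// powRr1 ?(ltW q0')//.
    by rewrite ler_wpM2l// ltW.
  apply: (@le_trans _ _ (q%:R `^ (- (t * (tau - 1))) * (pi * q%:R `^ (- (tau - 1))) `^ (- t))); last first.
    rewrite ler_wpM2l ?powR_ge0//; apply: powR_le_neg => //.
    by rewrite oppr_le0 ltW.
  rewrite powRM ?pi_ge0 ?powR_ge0// -powRrM mulrCA -powRD ?(gt_eqF q0') ?implybT//.
  have -> : - (t * (tau - 1)) + - (tau - 1) * - t = 0 by ring.
  by rewrite powRr0 mulr1.
(* The series starts at 1; extending it by 0 at the index 0 makes the criterion for series over all
   naturals applicable. *)
pose u k := if (0 < k)%N then fine (f k) else 0.
have u0 k : 0 <= u k by rewrite /u; case: ifP => // _; exact: fine_ge0.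
have ufin : (\sum_(k <oo) (u k)%:E < +oo)%E.
  move: fin; rewrite /sine_series eseries_cond eseries_mkcond.
  by under eq_eseriesr do rewrite -[X in (if _ then X else _)%E]fineK// -(fun_if EFin).
have := cvg_series_cvg_0 (nnseries_is_cvg u0 ufin).
move=> /cvgr0Pnorm_lt/(_ _ c0)[K _ KP].
have [q [p [Kq xpq]]] := approx K.
have q0 : (0 < q)%N by exact: leq_ltn_trans Kq.
have := KP q (ltnW Kq); rewrite ger0_norm// /u q0 ltNge.
by have := big q p q0 xpq; rewrite lee_fin => ->.
Qed.
End Sine.

(** * Recursively contracting and lacunary sums *)

Section Summation.
Context {R : realType}.

Lemma contraction_sum_bounded (u e : nat -> R) (v E : R) : 0 <= v -> v < 1 ->
  (forall k, 0 <= u k) -> (forall k, u k.+1 <= v * u k + e k.+1) ->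
  (forall n, \sum_(1 <= k < n) e k <= E) ->
  exists B, forall n, \sum_(0 <= k < n) u k <= B.
Proof.
move=> v0 v1 u0 ue eE; have w0 : 0 < 1 - v by rewrite subr_gt0.
exists ((u 0%N + E) / (1 - v)) => n; rewrite ler_pdivlMr//.
apply: (@le_trans _ _ (u 0%N + \sum_(1 <= k < n.+1) e k)); last by rewrite lerD2l.
(* Keeping the last term [v * u n] on the left makes the bound inductive: it is exactly what the
   recursion consumes at the next step. *)
suff : (1 - v) * \sum_(0 <= k < n.+1) u k + v * u n <= u 0%N + \sum_(1 <= k < n.+1) e k.
  apply: le_trans; rewrite [leLHS]mulrC [in leRHS]big_nat_recr//= mulrDr -addrA lerDl.
  by rewrite mulrBl mul1r subrK.
elim: n => [|n IH]; first by rewrite big_nat1 big_geq// addr0 mulrBl mul1r subrK.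
rewrite big_nat_recr//= [X in _ <= _ + X]big_nat_recr//=.
by have := ue n; move: IH; rewrite mulrDr !mulrBl !mul1r; lra.
Qed.

Lemma lacunary_sum_bounded (G : pred nat) (al la : R) (L0 : nat) : (0 < L0)%N ->
  0 < al -> 1 < la ->
  (forall l l', (L0 <= l)%N -> (l < l')%N -> G l -> G l' -> la * l%:R <= l'%:R) ->
  exists B, forall n, \sum_(L0 <= l < n | G l) l%:R `^ (- al) <= B.
Proof.
move=> L00 al0 la1 gap; pose w := la `^ (- al).
have la0 : 0 < la by exact: lt_trans la1.
have w0 : 0 < w by rewrite powR_gt0.
have w1 : w < 1.
  rewrite /w powR_expR// expR_lt1 mulNr oppr_lt0 mulr_gt0// ln_gt0//.
have w10 : 0 < 1 - w by rewrite subr_gt0.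
pose D := w / (1 - w); have D0 : 0 < D by rewrite divr_gt0.
have DE : (1 + D) * w = D by rewrite /D; field; rewrite gt_eqF.
exists (1 + D) => n.
(* The last selected index l carries the reserve [D * l%:R ^ (- al)], the geometric tail of all
   selected terms that may follow; by [DE] it pays for the next term and the next reserve. *)
suff [[-> _]|[l [_ _ _ h]]] :
    (\sum_(L0 <= l < n | G l) l%:R `^ (- al) = 0 /\
     forall l, (L0 <= l < n)%N -> ~~ G l) \/
    exists l, [/\ (L0 <= l)%N, (l < n)%N, G l &
    \sum_(L0 <= l < n | G l) l%:R `^ (- al) + D * l%:R `^ (- al) <= 1 + D].
- by rewrite addr_ge0// ltW.
- by apply: le_trans h; rewrite lerDl mulr_ge0 ?powR_ge0// ltW.
elim: n => [|n IH].
  by left; rewrite big_geq//; split=> // l; rewrite ltn0 andbF.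
have [L0n|nL0] := leqP L0 n; last first.
  left; rewrite big_geq//; split=> // l /andP[h1 h2].
  by move: nL0; rewrite ltnNge -ltnS (leq_ltn_trans h1).
rewrite big_mkcond big_nat_recr//= -big_mkcond/=.
have [Gn|nGn] := boolP (G n); last first.
  rewrite addr0; case: IH => [[-> nG]|[l [h1 h2 h3 h4]]].
    left; split=> // l; rewrite ltnS => /andP[h1]; rewrite leq_eqVlt => /predU1P[->//|h2].
    by apply: nG; rewrite h1.
  by right; exists l; split => //; exact: ltnW.
right; exists n; split => //.
case: IH => [[-> _]|[l [h1 h2 h3 h4]]].
  rewrite add0r -{1}[_ `^ _]mul1r -mulrDl ger_pMr ?addr_gt0//.
  rewrite powRN invf_le1 ?powR_gt0 ?ltr0n ?(leq_trans L00)//.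
  rewrite -[leLHS](powRr0 n%:R) ler_powR ?(ltW al0)// ler1n (leq_trans L00)//.
have l0 : 0 < l%:R :> R by rewrite ltr0n (leq_trans L00).
apply: le_trans h4; rewrite -addrA lerD2l -{1}[n%:R `^ _]mul1r -mulrDl -{2}DE -mulrA.
rewrite ler_wpM2l ?addr_ge0 ?(ltW D0)// -powRM ?(ltW la0) ?(ltW l0)//.
apply: powR_le_neg; rewrite ?oppr_le0 ?(ltW al0) ?mulr_gt0//.
exact: gap.
Qed.

Lemma sum_nat_uniq_le (F : nat -> R) (s : seq nat) (B : R) : (forall j, 0 <= F j) ->
  uniq s -> (forall j, j \in s -> (0 < j)%N) ->
  (forall n, \sum_(1 <= j < n) F j <= B) -> \sum_(j <- s) F j <= B.
Proof.
move=> F0 us s0 FB; pose J := (\max_(j <- s) j).+1.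
apply: le_trans (FB J); rewrite [leRHS](bigID (fun j => j \in s))/=.
rewrite -[leLHS]addr0 lerD ?sumr_ge0// -[leRHS]big_filter le_eqVlt; apply/orP; left; apply/eqP.
apply: perm_big; apply: uniq_perm => //; first by rewrite filter_uniq ?iota_uniq.
move=> j; rewrite mem_filter mem_index_iota ltnS.
case: (boolP (j \in s)) => //= js; rewrite s0//=; apply/esym.
by rewrite (leq_bigmax_seq (F := id)).
Qed.

Lemma minimizer (f : nat -> R) (N : nat) : (1 < N)%N ->
  exists2 n, (0 < n < N)%N & forall m, (0 < m < N)%N -> f n <= f m.
Proof.
case: N => [|[|N]] // _; elim: N => [|N [n n1 nP]].
  by exists 1%N => // m m1; have -> : m = 1%N by move: m1; clear; lia.
have [le|lt] := leP (f n) (f N.+2).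
  exists n; first by move: n1; clear; lia.
  move=> m /andP[m0]; rewrite ltnS leq_eqVlt => /predU1P[->//|mN].
  by apply: nP; rewrite m0.
exists N.+2; first by rewrite /= ltnSn.
move=> m /andP[m0]; rewrite ltnS leq_eqVlt => /predU1P[->//|mN].
by apply: le_trans (ltW lt) _; apply: nP; rewrite m0.
Qed.

End Summation.

(** * Convergence of the sine series off the limsup set *)

Section Convergence.
Context {R : realType} (t tau a x : R).
Context (t1 : 1 < t) (tau2 : 2 < tau) (a0 : 0 < a) (irx : irrational x).
Context (notN : ~ dyadic_limsup tau a x).

Let D (n : nat) : R := ndist (n%:R * x).
Let res (n : nat) : R := n%:R * x - (nint (n%:R * x))%:~R.

Let D_gt0 n : (0 < n)%N -> 0 < D n.
Proof. exact: ndist_gt0. Qed.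

Let pow_gt0 (k : nat) : 0 < 2 ^+ k :> R. Proof. by rewrite exprn_gt0. Qed.

Let D_ge : exists2 K0 : nat, (0 < K0)%N & forall k q, (K0 <= k)%N ->
  (2 ^ k <= q < 2 ^ k.+1)%N -> (2 ^+ k) `^ (- (tau - 1)) * k%:R `^ a <= D q.
Proof.
have [K0 K0P] : exists K0 : nat, forall k q (p : int), (K0 <= k)%N ->
    (2 ^ k <= q < 2 ^ k.+1)%N -> dyadic_radius tau a k <= `|x - p%:~R / q%:R|.
  apply: contrapT => H; apply: notN => K; apply: contrapT => H'; apply: H.
  exists K => k q p Kk qk; rewrite leNgt; apply/negP => h; apply: H'.
  by exists k, q, p.
exists K0.+1 => // k q /ltnW Kk qk; have /andP[q1 q2] := qk.
have q0 : 0 < q%:R :> R by rewrite ltr0n (leq_trans _ q1)// expn_gt0.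
have h := K0P k q (nint (q%:R * x)) Kk qk.
have -> : D q = q%:R * `|x - (nint (q%:R * x))%:~R / q%:R|.
  rewrite /D /ndist; move: (nint _) => m.
  have -> : q%:R * x - m%:~R = q%:R * (x - m%:~R / q%:R) by field; rewrite gt_eqF.
  by rewrite normrM gtr0_norm.
apply: (@le_trans _ _ (2 ^+ k * dyadic_radius tau a k)).
  rewrite /dyadic_radius mulrA opprB [1 - tau]addrC powRD ?(gt_eqF (pow_gt0 k)) ?implybT//.
  by rewrite powRr1 ?exprn_ge0// [_ * 2 ^+ k]mulrC.
apply: ler_pM; [exact: exprn_ge0 | by rewrite mulr_ge0// powR_ge0 | | exact: h].
by rewrite -natrX ler_nat.
Qed.

Let w_ex (k : nat) : exists n, (0 < n < 2 ^ k.+1)%N /\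
  forall m, (0 < m < 2 ^ k.+1)%N -> D n <= D m.
Proof.
have k1 : (1 < 2 ^ k.+1)%N by rewrite -{1}(expn0 2) ltn_exp2l.
by have [n n1 nP] := minimizer D k1; exists n.
Qed.

Let w k : nat := projT1 (cid (w_ex k)).
Let Phi k : R := D (w k).

Let wP k : (0 < w k < 2 ^ k.+1)%N /\ forall m, (0 < m < 2 ^ k.+1)%N -> Phi k <= D m.
Proof. by rewrite /Phi /w; case: (cid (w_ex k)) => n []. Qed.

Let Phi_gt0 k : 0 < Phi k.
Proof. by apply: D_gt0; have [/andP[]] := wP k. Qed.

Let res_sep k n n' : (2 ^ k <= n < 2 ^ k.+1)%N -> (2 ^ k <= n' < 2 ^ k.+1)%N ->
  n != n' -> Phi k <= `|res n - res n'|.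
Proof.
move=> nk nk'; wlog lt : n n' nk nk' / (n' < n)%N.
  move=> H ne; have [lt|lt|e] := ltngtP n n'.
  - by rewrite distrC; apply: H => //; rewrite eq_sym.
  - exact: H.
  - by rewrite e eqxx in ne.
move=> _; have [_ wmin] := wP k.
have h : (0 < n - n' < 2 ^ k.+1)%N by move: nk nk' lt; clear; lia.
apply: le_trans (wmin _ h) _.
have -> : res n - res n' = (n - n')%N%:R * x - (nint (n%:R * x) - nint (n'%:R * x))%:~R.
  by rewrite /res natrB ?(ltnW lt)// intrB; ring.
exact: ndist_le.
Qed.

(** Within a block, residues of equal sign are at least [Phi k] apart and of absolute value at least
    [Phi k], so the integer parts of [D n / Phi k] are distinct positive integers and the sum is
    compared with that of j^(-t). The factor 2 accounts for the two signs. *)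
Let block_sum (Z : R) k : (forall n, \sum_(1 <= j < n) j%:R `^ (- t) <= Z) ->
  \sum_(2 ^ k <= n < 2 ^ k.+1) D n `^ (- t) <= 2 * Z * Phi k `^ (- t).
Proof.
move=> ZP; have [_ wmin] := wP k; have Phi0 := Phi_gt0 k.
have half (b : bool) : \sum_(2 ^ k <= n < 2 ^ k.+1 | (0 <= res n) == b) D n `^ (- t)
    <= Z * Phi k `^ (- t).
  rewrite -big_filter; set s := [seq _ <- _ | _].
  have sP n : n \in s -> (2 ^ k <= n < 2 ^ k.+1)%N /\ (0 <= res n) = b.
    by rewrite mem_filter mem_index_iota => /andP[/eqP -> ->].
  pose j n := Num.truncn (D n / Phi k).
  have jP n : n \in s -> [/\ (0 < j n)%N, (j n)%:R <= D n / Phi k & D n / Phi k < (j n)%:R + 1].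
    move=> /sP[/andP[n1 n2] _]; have n0 : (0 < n)%N by rewrite (leq_trans _ n1)// expn_gt0.
    have q1 : 1 <= D n / Phi k by rewrite ler_pdivlMr// mul1r wmin// n0.
    have /andP[h1 h2] := truncn_itv (le_trans ler01 q1).
    by split => //; [rewrite truncn_gt0 | rewrite natr1].
  apply: (@le_trans _ _ (\sum_(n <- s) (j n)%:R `^ (- t) * Phi k `^ (- t))).
    rewrite big_seq [leRHS]big_seq; apply: ler_sum => n /jP[j0 jD _].
    rewrite -powRM ?(ltW Phi0)//; apply: powR_le_neg.
    - by rewrite oppr_le0 ltW// (lt_trans ltr01).
    - by rewrite mulr_gt0// ltr0n.
    - by rewrite -ler_pdivlMr.
  rewrite -mulr_suml ler_wpM2r ?powR_ge0// -(big_map j xpredT (fun i => i%:R `^ (- t))).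
  apply: sum_nat_uniq_le ZP => [i||i /mapP[n /jP[? _ _] ->//]]; first exact: powR_ge0.
  rewrite map_inj_in_uniq ?filter_uniq ?iota_uniq// => n n' ns n's jn.
  apply/eqP/negPn/negP => ne; have [nk nb] := sP _ ns; have [nk' nb'] := sP _ n's.
  have := res_sep nk nk' ne; have [_ h1 h2] := jP _ ns; have [_ h1' h2'] := jP _ n's.
  rewrite -jn in h1' h2'; rewrite !ler_pdivlMr// in h1 h1'.
  rewrite !ltr_pdivrMr// in h2 h2'; rewrite leNgt => /negP; apply.
  have -> : `|res n - res n'| = `|D n - D n'|.
    rewrite /D /ndist -/(res n) -/(res n').
    have : (0 <= res n) = (0 <= res n') by rewrite nb nb'.
    case: (leP 0 (res n)) => r1 r2.
      have r3 : 0 <= res n' by rewrite -r2.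
      by rewrite (ger0_norm r1) (ger0_norm r3).
    have r3 : res n' < 0 by rewrite ltNge -r2.
    rewrite (ltr0_norm r1) (ltr0_norm r3) -normrN; congr `|_|; ring.
  rewrite ltr_distl; move: h1 h2 h1' h2'; rewrite mulrDl mul1r.
  by move: (_ * Phi k) => J *; apply/andP; split; lra.
rewrite (bigID (fun n => 0 <= res n))/=.
have := half true; have := half false.
rewrite (eq_bigl _ _ (fun n => eqbF_neg _)) (eq_bigl _ _ (fun n => eqb_id _)).
move: (\sum_(_ <= _ < _ | _) _) (\sum_(_ <= _ < _ | _) _) (Phi k `^ _) => S1 S2 P; lra.
Qed.

Let th := tau - 1.
(** Half of the excess of tau - 1 over the Dirichlet exponent 1. A record no better than 2^(-l (1 +
    eta)) leaves a spare geometric factor 2^(-l eta t), while the better ones are spaced with ratio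
    about 1 + eta. *)
Let eta := (tau - 2) / 2.
(** As s = t(tau - 1), this is the order of the bound that [block_sum] gives for the terms of the
    sine series with 2^k <= n < 2^(k+1). *)
Let beta k : R := ((2 ^+ k) `^ (- th) / Phi k) `^ t.
(* [good l]: a record of [n |-> D n] occurs in [2^l, 2^(l+1)) and it is
   substantially better than Dirichlet's theorem guarantees. *)
Let good l := (Phi l < Phi l.-1) && (Phi l < (2 ^+ l) `^ (- (1 + eta))).

Let t_gt0 : 0 < t. Proof. exact: lt_trans t1. Qed.
Let eta_gt0 : 0 < eta. Proof. by rewrite /eta divr_gt0// subr_gt0. Qed.
Let th_eta : th = 1 + eta + eta. Proof. by rewrite /th /eta; field. Qed.
Let th_gt0 : 0 < th. Proof. by rewrite th_eta !addr_gt0. Qed.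

Let Phi_anti k l : (k <= l)%N -> Phi l <= Phi k.
Proof.
move=> kl; have [/andP[w0 wk] _] := wP k; have [_ wmin] := wP l.
by apply: wmin; rewrite w0 (leq_trans wk)// leq_exp2l.
Qed.

Let record_window l : (0 < l)%N -> Phi l < Phi l.-1 -> (2 ^ l <= w l < 2 ^ l.+1)%N.
Proof.
case: l => // l _ rec; have [/andP[w0 ->] _] := wP l.+1; rewrite andbT leqNgt.
apply/negP => wl; move: rec; have [_ wmin] := wP l.
by rewrite ltNge /= wmin// w0.
Qed.

(* If two records had the same rational approximation, the later one would
   be worse; hence the determinant of the two fractions is at least 1. *)
Let record_gap l l' : (0 < l)%N -> (l < l')%N -> good l -> good l' ->
  l%:R * (1 + eta) < l'%:R + 2.
Proof.
move=> l0 ll' /andP[rl gl] /andP[rl' _].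
have l'0 : (0 < l')%N by exact: leq_trans ll'.
have /andP[q1 q2] := record_window l0 rl.
have /andP[q1' q2'] := record_window l'0 rl'.
set q := w l in q1 q2; set q' := w l' in q1' q2'.
have qq' : (q < q')%N.
  by apply: leq_trans q2 _; apply: leq_trans q1'; rewrite leq_exp2l.
have q0 : (0 < q)%N by rewrite (leq_trans _ q1)// expn_gt0.
have q'0 : (0 < q')%N by exact: leq_ltn_trans qq'.
have lt' : Phi l' < Phi l.
  by apply: lt_le_trans rl' _; apply: Phi_anti; rewrite -ltnS prednK.
pose p := nint (q%:R * x); pose p' := nint (q'%:R * x).
have Q0 : 0 < q%:R :> R by rewrite ltr0n.
have Q'0 : 0 < q'%:R :> R by rewrite ltr0n.
have PE : Phi l = `|q%:R * x - p%:~R| by [].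
have PE' : Phi l' = `|q'%:R * x - p'%:~R| by [].
have ne : p * q'%:Z - p' * q%:Z != 0.
  apply/negP; rewrite subr_eq0 => /eqP e; move: lt'; rewrite ltNge => /negP; apply.
  have e' : q%:R * Phi l' = q'%:R * Phi l.
    rewrite PE PE' -{1}(gtr0_norm Q0) -[in RHS](gtr0_norm Q'0) -!normrM; congr `|_|.
    have : p%:~R * q'%:R = p'%:~R * q%:R :> R by rewrite !pmulrn -!intrM e.
    by rewrite !mulrBr => e1; rewrite [q%:R * p'%:~R]mulrC -e1 mulrCA [q'%:R * p%:~R]mulrC.
  rewrite -(ler_pM2l Q0) e' ler_wpM2r ?(ltW (Phi_gt0 l))// ler_nat ltnW//.
have one : 1 <= q'%:R * Phi l + q%:R * Phi l'.
  have : 1 <= `|(p * q'%:Z - p' * q%:Z)%:~R| :> R.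
    by rewrite -intr_norm (_ : 1 = 1%:~R)// ler_int -gtz0_ge1 normr_gt0.
  move=> /le_trans; apply.
  have -> : (p * q'%:Z - p' * q%:Z)%:~R =
     q%:R * (q'%:R * x - p'%:~R) - q'%:R * (q%:R * x - p%:~R) :> R.
    by rewrite intrB !intrM -!pmulrn; ring.
  by apply: le_trans (ler_normB _ _) _; rewrite !normrM (gtr0_norm Q0) (gtr0_norm Q'0) -PE -PE' addrC.
(* Both products in [one] are at most 2^(l'+1) times [Phi l]; their sum accounts for the exponent l'
   + 2, hence for the 2 in the conclusion. *)
have two : 1 < 2 ^+ l'.+2 * (2 ^+ l) `^ (- (1 + eta)) :> R.
  apply: le_lt_trans one _.
  apply: (@le_lt_trans _ _ (2 ^+ l'.+2 * Phi l)); last by rewrite ltr_pM2l.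
  have -> : 2 ^+ l'.+2 * Phi l = 2 ^+ l'.+1 * Phi l + 2 ^+ l'.+1 * Phi l.
    by rewrite [2 ^+ l'.+2]exprS; ring.
  apply: lerD.
    rewrite ler_wpM2r ?(ltW (Phi_gt0 l))// -natrX ler_nat; exact: ltnW.
  apply: ler_pM; [exact: ltW | exact/ltW/Phi_gt0 | | exact: ltW].
  by rewrite -natrX ler_nat (leq_trans (ltnW qq'))// ltnW.
move: two; rewrite pow2_expR -[2 ^+ _](powRr1 (ltW (pow_gt0 _))) pow2_expR mul1r.
rewrite -expRD expR_gt1 -[l'.+2%:R]natr1 -[l'.+1%:R]natr1.
have -> : ln 2 * (l'%:R + 1 + 1) + - (1 + eta) * ln 2 * l%:R =
   ln 2 * (l'%:R + 2 - l%:R * (1 + eta)) :> R by ring.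
by rewrite pmulr_rgt0 ?ln2_gt0// subr_gt0.
Qed.

(** Without a record [Phi] is unchanged and [beta] contracts by v. At a good record, avoidance of
    the limsup set gives [beta l <= l^(-a t)], summable along the lacunary good levels; at any other
    record [beta l <= u^l]. *)
Let beta_sum_bounded : exists B, forall n, \sum_(0 <= k < n) beta k <= B.
Proof.
have [K0 K00 K0P] := D_ge.
(* For l >= 4 / eta the additive 2 of [record_gap] is at most l eta / 2, which leaves the clean
   ratio 1 + eta / 2. *)
pose L0 := maxn K0 (Num.truncn (4 / eta)).+1.
have L0P l : (L0 <= l)%N -> [/\ (K0 <= l)%N, (0 < l)%N & 4 / eta <= l%:R].
  rewrite geq_max => /andP[h1 h2]; split=> //; first exact: leq_trans h1.
  by apply/ltW/(lt_le_trans (truncnS_gt _)); rewrite ler_nat.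
have at0 : 0 < a * t by rewrite mulr_gt0.
have la1 : 1 < 1 + eta / 2 by rewrite ltrDl divr_gt0.
have L00 : (0 < L0)%N by rewrite leq_max K00.
have [B1 B1P] := @lacunary_sum_bounded R good (a * t) (1 + eta / 2) L0 L00 at0 la1
  ltac:(move=> l l' /L0P[_ l0 l4] ll' gl gl';
    have := record_gap l0 ll' gl gl'; move: l4; rewrite ler_pdivrMr//; lra).
pose u := (2 : R) `^ (- (eta * t)).
have u0 : 0 <= u by exact: powR_ge0.
have u1 : u < 1.
  rewrite /u powR_expR// expR_lt1 mulNr oppr_lt0.
  exact: mulr_gt0 (mulr_gt0 eta_gt0 t_gt0) ln2_gt0.
have uX l : (2 ^+ l) `^ (- (eta * t)) = u ^+ l.
  by rewrite -powR_mulrn// powRAC powR_mulrn.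
pose v := (2 : R) `^ (- (th * t)).
have v1 : v < 1.
  rewrite /v powR_expR// expR_lt1 mulNr oppr_lt0.
  exact: mulr_gt0 (mulr_gt0 th_gt0 t_gt0) ln2_gt0.
have Pi k : 0 < (Phi k)^-1 by rewrite invr_gt0.
have step k : (L0 <= k)%N -> beta k.+1 <= v * beta k +
    ((if good k.+1 then k.+1%:R `^ (- (a * t)) else 0) + u ^+ k.+1).
  move=> /L0P[Kk k0 _].
  have b0 : 0 <= beta k by exact: powR_ge0.
  have [rec|norec] := ltP (Phi k.+1) (Phi k); last first.
    have e : Phi k.+1 = Phi k by apply/eqP; rewrite eq_le norec Phi_anti.
    have -> : beta k.+1 = v * beta k.
      have E : (2 ^+ k.+1) `^ (- th) = 2 `^ (- th) * (2 ^+ k) `^ (- th) :> R.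
        by rewrite exprS powRM// exprn_ge0.
      rewrite /beta e /v E -mulrA powRM ?powR_ge0//; last first.
        by rewrite mulr_ge0 ?powR_ge0// ltW.
      by congr (_ * _); rewrite -powRrM mulNr.
    by rewrite lerDl addr_ge0 ?exprn_ge0//; case: ifP => // _; exact: powR_ge0.
  apply: (@le_trans _ _ ((if good k.+1 then k.+1%:R `^ (- (a * t)) else 0) + u ^+ k.+1)); last first.
    by rewrite lerDr mulr_ge0// powR_ge0.
  have wk := record_window (ltn0Sn k) rec.
  have [gd|bad] := ltP (Phi k.+1) ((2 ^+ k.+1) `^ (- (1 + eta))).
    rewrite /good rec gd/= -[leLHS]addr0 lerD ?exprn_ge0//.
    have kk0 : 0 < k.+1%:R :> R by [].
    have -> : - (a * t) = - a * t by rewrite mulNr.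
    rewrite /beta powRrM; apply: ge0_ler_powR; rewrite ?nnegrE ?powR_ge0 ?(ltW t_gt0)//.
      by rewrite mulr_ge0 ?powR_ge0// ltW.
    rewrite ler_pdivrMr// [k.+1%:R `^ (- a)]powRN [leRHS]mulrC ler_pdivlMr ?powR_gt0//.
    by apply: K0P => //; exact: leqW.
  rewrite -[leLHS]add0r lerD//; first by case: ifP => // _; exact: powR_ge0.
  rewrite -uX -mulNr powRrM /beta.
  apply: ge0_ler_powR; rewrite ?nnegrE ?powR_ge0 ?(ltW t_gt0)//.
    by rewrite mulr_ge0 ?powR_ge0// ltW.
  rewrite ler_pdivrMr//; apply: (@le_trans _ _ ((2 ^+ k.+1) `^ (- eta) * (2 ^+ k.+1) `^ (- (1 + eta)))).
    by rewrite -powRD ?(gt_eqF (pow_gt0 _)) ?implybT// th_eta -opprD [eta + _]addrC.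
  by rewrite ler_wpM2l// powR_ge0.
pose e l := (if good (l + L0)%N then (l + L0)%N%:R `^ (- (a * t)) else 0) + u ^+ (l + L0).
have geo n : \sum_(0 <= k < n) u ^+ k <= (1 - u)^-1.
  have u10 : 0 < 1 - u by rewrite subr_gt0.
  rewrite -[leRHS]mul1r ler_pdivlMr//.
  have -> : (\sum_(0 <= k < n) u ^+ k) * (1 - u) = 1 - u ^+ n.
    elim: n => [|n IH]; first by rewrite big_geq// mul0r expr0 subrr.
    by rewrite big_nat_recr//= mulrDl IH exprS; ring.
  by rewrite gerBl exprn_ge0.
have eE n : \sum_(1 <= k < n) e k <= B1 + (1 - u)^-1.
  rewrite big_split/=; apply: lerD.
    apply: le_trans (B1P (n + L0)%N); rewrite [leRHS]big_mkcond/=.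
    have [n0|n0] := posnP n.
      by rewrite n0 !big_geq// sumr_ge0.
    rewrite -{3}[L0]add0n big_addn addnK [leRHS](@big_cat_nat _ _ _ 1 0 n)//=.
    by rewrite lerDr sumr_ge0// => k _; case: ifP => // _; exact: powR_ge0.
  apply: le_trans (geo n).
  have [n0|n0] := posnP n; first by rewrite n0 !big_geq.
  rewrite [leRHS](@big_cat_nat _ _ _ 1 0 n)//= -[leLHS]add0r lerD//.
    by apply: sumr_ge0 => k _; exact: exprn_ge0.
  apply: ler_sum => k _; rewrite exprD ler_piMr ?exprn_ge0//.
  by rewrite exprn_ile1// ltW.
have [B BP] := contraction_sum_bounded (powR_ge0 _ _) v1 (fun k => powR_ge0 _ _)
  (fun k => step _ (leq_addl k L0)) eE.
exists (\sum_(0 <= k < L0) beta k + B) => n.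
apply: (@le_trans _ _ (\sum_(0 <= k < n + L0) beta k)).
  rewrite (@big_cat_nat _ _ _ n 0 (n + L0))//= ?leq_addr// lerDl.
  by apply: sumr_ge0 => k _; exact: powR_ge0.
rewrite (@big_cat_nat _ _ _ L0 0 (n + L0))//= ?leq_addl// lerD2l.
by rewrite -{1}[L0]add0n big_addn addnK.
Qed.

Lemma sine_series_finite (s : R) : s = t * (tau - 1) -> (sine_series s t x < +oo)%E.
Proof.
move=> sE; have [B BP] := beta_sum_bounded.
have [Z ZP] := p_series_bounded t1.
have Z0 : 0 <= Z by have := ZP 0%N; rewrite big_geq.
pose c : R := (2^-1) `^ (- t).
pose f n : R := n%:R `^ (- s) * `|sin (pi * n%:R * x)| `^ (- t).
have f0 n : 0 <= f n by rewrite mulr_ge0// powR_ge0.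
have s0 : 0 < s by rewrite sE mulr_gt0.
have blk k : \sum_(2 ^ k <= n < 2 ^ k.+1) f n <= c * (2 * Z) * beta k.
  have -> : c * (2 * Z) * beta k = ((2 ^+ k) `^ (- s) * c) * (2 * Z * Phi k `^ (- t)).
    rewrite /beta powRM ?powR_ge0 ?invr_ge0 ?(ltW (Phi_gt0 k))// -powRrM.
    rewrite -(powR_inv1 (ltW (Phi_gt0 k))) -powRrM mulN1r.
    have -> : - th * t = - s by rewrite sE /th; ring.
    ring.
  apply: le_trans (ler_wpM2l _ (block_sum k ZP)); last by rewrite mulr_ge0// powR_ge0.
  rewrite mulr_sumr; apply: ler_sum_nat => n /andP[n1 n2].
  have n0 : (0 < n)%N by rewrite (leq_trans _ n1)// expn_gt0.
  rewrite -mulrA; apply: ler_pM; rewrite ?powR_ge0//.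
    by apply: powR_le_neg; rewrite ?oppr_le0 ?(ltW s0)// -natrX ler_nat.
  rewrite -powRM ?invr_ge0 ?(ltW (D_gt0 n0))//; apply: powR_le_neg.
  - by rewrite oppr_le0 ltW.
  - by rewrite mulr_gt0// D_gt0.
  - by rewrite -[pi * n%:R * x]mulrA mulrC; exact: sin_ge_ndist.
have C0 : 0 <= c * (2 * Z) by rewrite mulr_ge0 ?powR_ge0// mulr_ge0.
have bd K : \sum_(1 <= n < 2 ^ K) f n <= c * (2 * Z) * B.
  apply: le_trans (ler_wpM2l C0 (BP K)); elim: K => [|K IH].
    by rewrite expn0 !big_geq// mulr0.
  rewrite (@big_cat_nat _ _ _ (2 ^ K))//= ?expn_gt0// ?leq_exp2l//.
  by rewrite [in leRHS]big_nat_recr//= mulrDr lerD.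
apply: (@le_lt_trans _ _ (c * (2 * Z) * B)%:E); last by rewrite ltry.
rewrite /sine_series; apply: lime_le.
  by apply: is_cvg_nneseries => n _ _; rewrite lee_fin; exact: f0.
apply: nearW => n; rewrite sumEFin lee_fin; apply: le_trans (bd n).
have nn : (n <= 2 ^ n)%N by apply/ltnW/ltn_expl.
have [n0|n0] := posnP n; first by rewrite n0 big_geq// sumr_ge0.
by rewrite [leRHS](@big_cat_nat _ _ _ n 1 (2 ^ n))//= lerDl sumr_ge0.
Qed.

End Convergence.

(** * The critical fibre and the comparison of gauges *)

Section Fibre.
Context {R : realType}.
Implicit Types (t tau a kappa x : R).

Lemma thin_subset (g : R -> R) (A B : set R) : A `<=` B -> thin g B -> thin g A.
Proof.
by move=> AB [c [d [d0 ds dB cov]]]; exists c, d; split => // x /AB; exact: cov.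
Qed.

(** Avoiding the limsup set does double duty: it excludes the rationals and every point of exponent
    above tau. Membership in the well approximable set gives the other inequality. *)
Lemma critical_fibre tau kappa a x : 2 < tau ->
  well_approximable tau kappa x -> ~ dyadic_limsup tau a x ->
  irrational x /\ irr_exponent x = tau%:E.
Proof.
move=> t2 Wx Nx; have irx : irrational x.
  by move=> /(rational_dyadic_limsup tau a).
split => //; apply/eqP; rewrite eq_le (well_approximable_irr_exponent t2 irx Wx) andbT.
have t0 : 0 < tau by exact: lt_trans t2.
by rewrite leNgt; apply/negP => /(lt_irr_exponent a t0).
Qed.

Lemma gauge_le_exponent (p kappa kappa' r : R) : kappa <= kappa' -> 0 < r -> r < expR (- 1) ->
  gauge p kappa r <= gauge p kappa' r.
Proof.
move=> kk r0 re; rewrite /gauge ler_wpM2l ?powR_ge0// ler_powR//.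
by rewrite mul1r lnV ?posrE// lerNr -ler_expR lnK ?posrE// ltW.
Qed.

Lemma log_gauge_lower tau kappa kappa' (h : R -> R) : is_log_gauge tau kappa h ->
  kappa' <= kappa -> exists2 r0, 0 < r0 &
    forall r, 0 < r < r0 -> gauge (2 / tau) kappa' r <= h r.
Proof.
move=> [_ [r0 /andP[r00 _] hr]] kk; exists (Num.min r0 (expR (- 1))).
  by rewrite lt_min r00 expR_gt0.
move=> r /andP[rp]; rewrite lt_min => /andP[rr0 re].
by rewrite hr ?rp//; exact: gauge_le_exponent.
Qed.

End Fibre.

Theorem theorem7p5 (R : realType) (t tau s : R)
    (ht : 1 < t) (htau : 2 < tau) (hs : s = t * (tau - 1)) :
  let C := critical_convergent s t tau in
  let E := critical_divergent s t tau in
  [/\ forall (kappa : R) (h : R -> R), is_log_gauge tau kappa h ->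
        [/\ hausdorff_measure h C = +oo%E,
            kappa < -1 -> hausdorff_measure h E = 0%E
          & -1 <= kappa -> hausdorff_measure h E = +oo%E],
      [set x : R | irr_exponent x = tau%:E] = C `|` E,
      C `&` E = set0
    & forall (kappa : R) (h : R -> R), is_log_gauge tau kappa h ->
        (separates h C E <-> kappa < -1)].
Proof.
move=> C E.
have tau0 : 0 < tau by exact: lt_trans htau.
have finN a x : 0 < a -> irrational x -> ~ dyadic_limsup tau a x ->
    (sine_series s t x < +oo)%E.
  by move=> a0 irx Nx; exact: sine_series_finite ht htau a0 irx Nx s hs.
have main (kappa : R) (h : R -> R) : is_log_gauge tau kappa h ->
    [/\ hausdorff_measure h C = +oo%E,
        kappa < -1 -> hausdorff_measure h E = 0%E
      & -1 <= kappa -> hausdorff_measure h E = +oo%E].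
  move=> hk; have [hh [r0 /andP[r00 _] hr]] := hk; split.
  (* With a = tau / 4, thinness asks for kappa0 + 1/2 < -1, which holds for kappa0 <= -2; larger
     kappa are reached through the monotonicity of the gauge in the exponent. *)
  - pose kappa0 := Num.min kappa (- 2).
    have k02 : kappa0 <= - 2 by rewrite ge_min lexx orbT.
    have k01 : kappa0 <= - 1 by lra.
    have a0 : 0 < tau / 4 by rewrite divr_gt0.
    have kk : kappa0 <= kappa by rewrite ge_min lexx.
    have [r1 r10 hr1] := log_gauge_lower hk kk.
    apply: (hausdorff_measure_well_approximable htau k01 hh r10 hr1 (N := dyadic_limsup tau (tau / 4))).
    + apply: dyadic_limsup_thin => //; first lra.
      have -> : 2 * (tau / 4) / tau = 1 / 2 by field; rewrite gt_eqF.
      lra.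
    + move=> x Wx; have [Nx|Nx] := pselect (dyadic_limsup tau (tau / 4) x); first by right.
      have [irx mux] := critical_fibre htau Wx Nx.
      by left; split => //; exact: finN Nx.
  (* This a is positive exactly because kappa < -1, and it gives kappa + 2 a / tau = (kappa - 1) / 2
     < -1. *)
  - move=> k1; pose a := - (kappa + 1) * tau / 4.
    have a0 : 0 < a by rewrite /a divr_gt0// mulr_gt0//; lra.
    apply: (@thin_measure0 _ h (gauge (2 / tau) kappa) r0) => //.
      by move=> x; rewrite mulr_ge0// powR_ge0.
    apply: (@thin_subset _ _ _ (dyadic_limsup tau a)).
      move=> x [irx _ sx]; apply: contrapT => Nx.
      by have := finN a x a0 irx Nx; rewrite sx ltxx.
    apply: dyadic_limsup_thin => //; first lra.
    have -> : 2 * a / tau = - (kappa + 1) / 2 by rewrite /a; field; rewrite gt_eqF.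
    lra.
  (* At the gauge exponent -1 the excluded set is thin only for negative a; -1 is one choice, and
     any sign of a suffices to force mu <= tau. Divergence itself comes from the approximations of
     order q^(-tau). *)
  - move=> k1; have [r1 r10 hr1] := log_gauge_lower hk k1.
    apply: (hausdorff_measure_well_approximable htau (lexx _) hh r10 hr1 (N := dyadic_limsup tau (- 1))).
      apply: dyadic_limsup_thin => //.
      have : 0 < 2 / tau by rewrite divr_gt0.
      have -> : 2 * - 1 / tau = - (2 / tau) by ring.
      lra.
    move=> x Wx; have [Nx|Nx] := pselect (dyadic_limsup tau (- 1) x); first by right.
    have [irx mux] := critical_fibre htau Wx Nx.
    left; split => //; apply: sine_series_pinfty ht htau hs irx _ => K.
    have [k [y [Kk [p [q [/andP[q1 q2] ->]]] xy]]] := Wx K.+1.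
    exists q, p%:Z; split.
      by rewrite (leq_trans Kk)// (leq_trans (scale_ge k))// (leq_trans _ q1)// leq_pmull.
    apply: le_trans xy _; rewrite /radius addNr oppr0 !mul0r powRr0 mulr1.
    have q0 : (0 < q)%N by rewrite (leq_trans _ q1)// muln_gt0 scale_gt0.
    apply: powR_le_neg; rewrite ?oppr_le0 ?(ltW tau0) ?ltr0n//.
    by rewrite -natrM ler_nat ltnW.
split => //.
- apply/seteqP; split=> [x /= mux|x [[]|[]]//].
  have irx := irr_exponent_irrational htau mux.
  have [fin|] := ltP (sine_series s t x) +oo%E; first by left.
  by rewrite leye_eq => /eqP sx; right.
- by apply/seteqP; split => // x [[_ _ fin] [_ _ inf]]; rewrite inf ltxx in fin.
- move=> kappa h /main[CE E0 Eoo]; split=> [[_ E0']|k1]; last by split; [|exact: E0].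
  by rewrite ltNge; apply/negP => /Eoo; rewrite E0'.
Qed.
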